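(* A flat discrete-time system $x^{+}=f(x,u)$, $\dim(x)=n$, $\dim(u)=m$, with a flat output of the form $y^{j}=\varphi^{j}(\zeta_{[-q_{1}]},\dots,\zeta_{[-1]},x,u)$, $j=1,\ldots,m$, can be exactly linearized with respect to this flat output by a feedback of the form $$u=F_{u}\circ\phi(\zeta_{[-q_{1},-1]},x,v_{[0,R-\kappa]}),$$ such that the input-output behaviour of the closed-loop system is given by $y_{[\kappa]}=v$, where the multi-index $\kappa$ and the map $\phi$ are those defined in the context. If the flat output is independent of the variables $\zeta_{[-q_{1}]},\dots,\zeta_{[-1]}$, then the feedback has the form $$u=F_{u}\circ\phi(x,v_{[0,R-\kappa]}),$$ and $\#\kappa=n$.
   Context: System. All functions are smooth and all considerations are local, in a suitable neighborhood of an equilibrium $(x_0,u_0)$, $x_0=f(x_0,u_0)$. The system is $x^{i,+}=f^i(x,u)$, $i=1,\dots,n$, $u=(u^1,\dots,u^m)$, with $\mathrm{rank}(\partial_{(x,u)}f)=n$. Fix $m$ functions $g(x,u)$ such that $(x,u)\mapsto(x^+,\zeta)=(f(x,u),g(x,u))$ is locally invertible. Shifts. Trajectories on a finite time interval are identified with points of a manifold with coordinates $(\zeta_{[-l_\zeta]},\dots,\zeta_{[-1]},x,u,u_{[1]},\dots,u_{[l_u]})$, where $\zeta_{[-\beta]}$ stands for $\zeta(k-\beta)$, $u_{[\alpha]}$ for $u(k+\alpha)$, and $l_\zeta,l_u$ are sufficiently large. The forward-shift operator is $$\delta(h(\dots,\zeta_{[-2]},\zeta_{[-1]},x,u,u_{[1]},\dots))=h(\dots,\zeta_{[-1]},g(x,u),f(x,u),u_{[1]},u_{[2]},\dots).$$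 Flatness. The system is flat around $(x_0,u_0)$ if $x$ and $u$ can be expressed locally by an $m$-tuple of functions $y^j=\varphi^j(\zeta_{[-q_1]},\dots,\zeta_{[-1]},x,u,\dots,u_{[q_2]})$ (a flat output) and their forward-shifts $y_{[\alpha]}=\delta^\alpha(\varphi)$ up to some finite order. The representation is unique and has the form $x=F_x(y_{[0,R-1]})$, $u=F_u(y_{[0,R]})$, where the multi-index $R=(r^1,\dots,r^m)$ consists of the numbers of forward-shifts of each component of the flat output needed to express $x$ and $u$. Multi-indices. $+$, $-$ are componentwise; $A\pm c=(a^1\pm c,\dots,a^m\pm c)$; $\#A=\sum_j a^j$; $y_{[A]}=(y^1_{[a^1]},\dots,y^m_{[a^m]})$; $y_{[A,B]}$ collects all $y^j_{[\alpha]}$ with $a^j\le\alpha\le b^j$ (empty for $j$ if $a^j>b^j$). A lower index $0$ means all lower indices are $0$. For blocks $y_i$ the first subscript is the block and the bracketed subscript the shift. $\zeta_{[-q_1,-1]}=(\zeta_{[-q_1]},\dots,\zeta_{[-1]})$. The procedure defining $\kappa$. Set $\varphi_{rest_0}=\varphi$, $u_{rest_0}=u$. Step 1: determine $K_1=(k_1^1,\dots,k_1^m)$ such that $\delta^{k_1^j-1}(\varphi^j)$ depends only on $\zeta_{[-q_1,-1]},x$ while $\delta^{k_1^j}(\varphi^j)=\varphi^j_{[k_1^j]}(\zeta_{[-q_1,-1]},x,u)$ depends explicitly on $u$ (first order of shift with explicit dependence on $u$). Put $m_1=\mathrm{rank}(\partial_u\varphi_{[K_1]})$. Reorder the components of the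 flat output and of $u$ such that $\mathrm{rank}(\partial_{u_1}\varphi_{1,[\kappa_1]})=m_1$, where $\varphi_1$, $u_1$, $\kappa_1$ consist of the first $m_1$ components of $\varphi$, $u$, $K_1$. Apply the coordinate transformation $v_{1,[\alpha]}=\varphi_{1,[\kappa_1+\alpha]}$, $\alpha\ge0$, which replaces $u_1$ and its forward-shifts by $v_1$ and its forward-shifts; the remaining inputs $u_{rest_1}=(u^{m_1+1},\dots,u^m)$ and their forward-shifts stay as coordinates. Let $\varphi_{rest_1}=(\varphi^{m_1+1},\dots,\varphi^m)$, expressed with its shifts in the new coordinates. Step $i\ge2$: determine the multi-index $K_i$ (one entry $k_i^j$ for each component of $\varphi_{rest_{i-1}}$) such that $\delta^{k_i^j-1}(\varphi^j_{rest_{i-1}})$ depends only on $\zeta_{[-q_1,-1]},x,v_1,v_{1,[1]},\dots,v_{i-1},v_{i-1,[1]},\dots$ while $\delta^{k_i^j}(\varphi^j_{rest_{i-1}})$ depends explicitly also on $u_{rest_{i-1}}$ (first order of shift for which this happens). Put $m_i=\mathrm{rank}(\partial_{u_{rest_{i-1}}}\varphi_{rest_{i-1},[K_i]})$, reorder the components of $\varphi_{rest_{i-1}}$ and $u_{rest_{i-1}}$ such that $\mathrm{rank}(\partial_{u_i}\varphi_{i,[\kappa_i]})=m_i$, where $\varphi_i,u_i,\kappa_i$ consist of the first $m_i$ components of $\varphi_{rest_{i-1}},u_{rest_{i-1}},K_i$, and apply the coordinate transformation $v_{i,[\alpha]}=\varphi_{i,[\kappa_i+\alpha]}$, $\alpha\ge0$,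 replacing $u_i$ and its forward-shifts by $v_i$ and its forward-shifts, with the remaining inputs $u_{rest_i}$ left unchanged. (Some of the highest forward-shifts of inputs may have to be kept as coordinates because the manifold is finite-dimensional; this is immaterial if $l_u$ is sufficiently large.) Let $\varphi_{rest_i}$ be the remaining components. The procedure terminates (after at most $m$ steps) in the step $s$ in which $\mathrm{rank}(\partial_{u_{rest_{s-1}}}\varphi_{rest_{s-1},[K_s]})=\dim(u_{rest_{s-1}})$; then $\varphi_s=\varphi_{rest_{s-1}}$, $\kappa_s=K_s$. Put $\kappa=(\kappa_1,\dots,\kappa_s)$, $v=(v_1,\dots,v_s)=\delta^\kappa(\varphi)$, $y=(y_1,\dots,y_s)$ with $\dim(y_i)=m_i$, and let $r_i$ be the components of $R$ corresponding to $y_i$. It holds that $\kappa\le R$. The map $\phi$. In the constructed coordinates, for each $i$ the shifts $y_{i,[0,\kappa_i-1]}$ are functions $\varphi_{i,[0,\kappa_i-1]}(\zeta_{[-q_1,-1]},x,v_{1,[0,r_1-\kappa_1-1]},\dots,v_{i-1,[0,r_{i-1}-\kappa_{i-1}-1]})$. The map $y_{[0,R]}=\phi(\zeta_{[-q_1,-1]},x,v_{[0,R-\kappa]})$ is defined by $$y_{i,[0,\kappa_i-1]}=\varphi_{i,[0,\kappa_i-1]}(\zeta_{[-q_1,-1]},x,v_{1,[0,r_1-\kappa_1-1]},\dots,v_{i-1,[0,r_{i-1}-\kappa_{i-1}-1]}),\qquad y_{i,[\kappa_i,r_i]}=v_{i,[0,r_i-\kappa_i]},\qquad i=1,\dots,s.$$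 Closed loop. $v$ is the new input and $v_{[\alpha]}$ stands for $v(k+\alpha)$. The input-output behaviour $y_{[\kappa]}=v$ means that along closed-loop trajectories each component of the flat output satisfies $y^j(k+\kappa^j)=v^j(k)$, where $\kappa^j$ is the corresponding component of $\kappa$ (with the components of $y$ ordered as in the procedure). *)

(* Defs.v *)
From HB Require Import structures.
From mathcomp Require Import all_boot all_order all_algebra all_fingroup.
From mathcomp Require Import all_classical all_reals all_analysis.
Import Order.TTheory GRing.Theory Num.Theory numFieldNormedType.Exports.

Set Implicit Arguments.
Unset Strict Implicit.
Unset Printing Implicit Defensive.

Local Open Scope classical_set_scope.
Local Open Scope ring_scope.

Section Smooth.
Context {R : realType}.

(* C^infinity on a neighborhood of p, one neighborhood for all orders: every
   iterated directional derivative of h is differentiable at every point. *)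
Definition smooth_near (V W : normedModType R) (p : V) (h : V -> W) : Prop :=
  \forall z \near p, forall dirs : seq V,
    differentiable (foldr (fun d h' => 'D_d h') h dirs) z.

Definition local_diffeo (N : nat) (p : 'rV[R]_N) (h : 'rV[R]_N -> 'rV[R]_N) :=
  smooth_near p h /\
  exists h' : 'rV[R]_N -> 'rV[R]_N,
    [/\ smooth_near (h p) h',
        (\forall z \near p, h' (h z) = z) &
        (\forall w \near h p, h (h' w) = w)].

End Smooth.

Section Multiindex.
Context {R : realType} {m : nat}.

(* A multi-index A has one entry per component. The collection w_[0,A-1] of
   all w^j_[a] with 0 <= a <= A^j - 1 is a vector of R^#A whose coordinates
   are indexed by the pairs (j, a). Thus w_[0,A] is [jet (A + 1) w]. *)
Definition pairs (A : 'I_m -> nat) := {j : 'I_m & 'I_(A j)}.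

Definition jetspace (A : 'I_m -> nat) := 'rV[R]_(#|{: pairs A}|).

Definition jet (A : 'I_m -> nat) (w : nat -> 'rV[R]_m) : jetspace A :=
  \row_i w (tagged (enum_val i : pairs A)) ord0 (tag (enum_val i : pairs A)).

(* Left inverse of [jet A] on the entries 0 <= a < A^j; other entries are 0. *)
Definition unjet (A : 'I_m -> nat) (V : jetspace A) (a : nat) : 'rV[R]_m :=
  \row_j (if insub a is Some b
          then V ord0 (enum_rank (@Tagged _ j (fun l => 'I_(A l)) b : pairs A))
          else 0).

End Multiindex.

Section Trajectories.
Context {R : realType} {q n m : nat}.

(* Row b of [past] is zeta_[-(b+1)], and [inp a] is the input shifted a times.
   The input sequence is infinite, so that "l_u sufficiently large" needs no
   bookkeeping; local statements only restrict finitely many inputs. *)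
Record traj := Traj {
  past : 'M[R]_(q, m);
  state : 'rV[R]_n;
  inp : nat -> 'rV[R]_m }.

(* The point of the finite-dimensional manifold of trajectories with the
   inputs u, u_[1], ..., u_[N-1]. *)
Definition window (N : nat) (z : traj) :
    ('M[R]_(q, m) * 'rV[R]_n * 'M[R]_(N, m))%type :=
  (past z, state z, \matrix_(a < N) inp z a).

Definition traj_nbhs (p : traj) : set_system traj :=
  [set P | exists N : nat,
     \forall c \near window N p, forall z, window N z = c -> P z].

Definition traj_smooth (p : traj) (h : traj -> R) : Prop :=
  exists (N : nat) (H : 'M[R]_(q, m) * 'rV[R]_n * 'M[R]_(N, m) -> R),
    smooth_near (window N p) H /\
    \forall z \near traj_nbhs p, h z = H (window N z).

(* h does not depend, near p, on the inputs w^j_[a] with S a j. *)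
Definition indep_of (S : nat -> 'I_m -> bool) (p : traj) (h : traj -> R) :=
  \forall z \near traj_nbhs p & z' \near traj_nbhs p,
    past z = past z' -> state z = state z' ->
    (forall a j, ~~ S a j -> inp z a ord0 j = inp z' a ord0 j) ->
    h z = h z'.

Definition set_input0 (z : traj) (w : 'rV[R]_m) : traj :=
  Traj (past z) (state z) (fun a => if a is a'.+1 then inp z a'.+1 else w).

(* Appends the newest value of zeta and forgets the oldest one. *)
Definition push (Z : 'M[R]_(q, m)) (zeta : 'rV[R]_m) : 'M[R]_(q, m) :=
  \matrix_(b < q, c < m) (col_mx zeta Z) (widen_ord (leqnSn q) b) c.

Section System.
Context (f : 'rV[R]_(n + m) -> 'rV[R]_n) (g : 'rV[R]_(n + m) -> 'rV[R]_m).
Context (phi : 'M[R]_(q, m) * 'rV[R]_n * 'rV[R]_m -> 'rV[R]_m).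

(* One time step, where the feedback [fb] computes the input u of the system
   from the past, the state and the sequence stored in [inp]. *)
Definition step (fb : traj -> 'rV[R]_m) (z : traj) : traj :=
  Traj (push (past z) (g (row_mx (state z) (fb z))))
       (f (row_mx (state z) (fb z)))
       (fun a => inp z a.+1).

Definition output (fb : traj -> 'rV[R]_m) (k : nat) (z : traj) : 'rV[R]_m :=
  let zk := iter k (step fb) z in phi (past zk, state zk, fb zk).

(* The forward-shift of functions on the trajectory manifold is precomposition
   with [step open_loop], so [shifted_output k] is delta^k(phi). *)
Definition open_loop (z : traj) : 'rV[R]_m := inp z 0%N.

Definition shifted_output := output open_loop.

Context (x0 : 'rV[R]_n) (u0 : 'rV[R]_m).

Definition eq_past : 'M[R]_(q, m) := \matrix_(b < q) g (row_mx x0 u0).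

Definition eq_traj : traj := Traj eq_past x0 (fun=> u0).

Definition eq_output : 'rV[R]_m := phi (eq_past, x0, u0).

Definition system_at : Prop :=
  [/\ f (row_mx x0 u0) = x0,
      smooth_near (row_mx x0 u0) f,
      \rank ('J f (row_mx x0 u0)) = n &
      local_diffeo (row_mx x0 u0) (fun z => row_mx (f z) (g z))].

(* x = F_x(y_[0,r-1]) and u = F_u(y_[0,r]). *)
Definition flat_parametrization (r : 'I_m -> nat)
    (Fx : jetspace r -> 'rV[R]_n)
    (Fu : jetspace (fun j => (r j).+1) -> 'rV[R]_m) : Prop :=
  [/\ smooth_near (jet r (fun=> eq_output)) Fx,
      smooth_near (jet (fun j => (r j).+1) (fun=> eq_output)) Fu &
      \forall z \near traj_nbhs eq_traj,
        state z = Fx (jet r (shifted_output ^~ z)) /\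
        inp z 0%N = Fu (jet (fun j => (r j).+1) (shifted_output ^~ z))].

(* Minimality of r: these are the numbers of forward-shifts that are needed. *)
Definition flat_output (r : 'I_m -> nat)
    (Fx : jetspace r -> 'rV[R]_n)
    (Fu : jetspace (fun j => (r j).+1) -> 'rV[R]_m) : Prop :=
  [/\ smooth_near (eq_past, x0, u0) phi,
      flat_parametrization Fx Fu &
      forall r' (Fx' : jetspace r' -> 'rV[R]_n)
          (Fu' : jetspace (fun j => (r' j).+1) -> 'rV[R]_m),
        flat_parametrization Fx' Fu' -> forall j, (r j <= r' j)%N].

(* The procedure. Instead of renumbering, the component y^j belongs to the
   block [blk j] in {1, ..., s}, and [tau j] is the index of the input that is
   replaced, in step [blk j], by v^j. All tuples keep the labels j. *)
Section Procedure.
Context (s : nat) (blk : 'I_m -> nat) (tau : {perm 'I_m}).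
Context (K : nat -> 'I_m -> nat).

Definition block (i : nat) : {set 'I_m} := [set j | blk j == i]%SET.
Definition rest (i : nat) : {set 'I_m} := [set j | (i < blk j)%N]%SET.

Definition kappa (j : 'I_m) : nat := K (blk j) j.

(* The coordinates after step i: slot j holds v^j = y^j_[kappa^j] and its
   shifts if y^j was treated in one of the steps 1, ..., i, and the input
   u^(tau j) and its shifts otherwise. *)
Definition coords (i : nat) (z : traj) : traj :=
  Traj (past z) (state z)
    (fun a => \row_j (if (blk j <= i)%N
                      then shifted_output (kappa j + a) z ord0 j
                      else inp z a ord0 (tau j))).

(* E is the expression of h in the coordinates after step i. *)
Definition expressed_by (i : nat) (h E : traj -> R) : Prop :=
  traj_smooth (coords i eq_traj) E /\
  \forall z \near traj_nbhs eq_traj, h z = E (coords i z).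

(* Matrix of the partial derivatives of E^j, j in A, with respect to the
   unshifted inputs in the slots A. *)
Definition input_jacobian (A : {set 'I_m}) (E : 'I_m -> traj -> R)
    (c : traj) : 'M[R]_(#|A|, #|A|) :=
  mxsub (fun a : 'I_#|A| => enum_val a) (fun b : 'I_#|A| => enum_val b)
    ('J (fun w : 'rV[R]_m => (\row_j E j (set_input0 c w) : 'rV[R]_m))
       (inp c 0%N)).

(* Step i, performed in the coordinates after step i-1, in which E j k is
   the expression of y^j_[k]. *)
Definition procedure_step (i : nat) : Prop :=
  exists E : 'I_m -> nat -> traj -> R,
    let c0 := coords i.-1 eq_traj in
    let EK := fun j => E j (K i j) in
    [/\ (forall j k, j \in rest i.-1 -> (k <= K i j)%N ->
           expressed_by i.-1 (fun z => shifted_output k z ord0 j) (E j k)),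
        (forall j k, j \in rest i.-1 -> (k < K i j)%N ->
           indep_of (fun=> mem (rest i.-1)) c0 (E j k)),
        (forall j, j \in rest i.-1 ->
           ~ indep_of (fun a l => (a == 0%N) && (l \in rest i.-1)) c0 (EK j)),
        (\forall c \near traj_nbhs c0,
           \rank (input_jacobian (rest i.-1) EK c) = #|block i|) &
        (\forall c \near traj_nbhs c0,
           \rank (input_jacobian (block i) EK c) = #|block i|)].

(* The rank found in step i is #|block i|; the procedure stops in the first
   step in which it equals the number of remaining inputs. *)
Definition procedure : Prop :=
  [/\ (0 < s)%N,
      (forall j, (0 < blk j)%N),
      (forall i, (0 < i <= s)%N -> procedure_step i),
      (forall i, (0 < i < s)%N -> (#|block i| < #|rest i.-1|)%N) &
      #|block s| = #|rest s.-1|].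

(* The shifts v_[0,r-kappa], and, for y^j in block i, the shifts
   v_{l,[0,r_l-kappa_l-1]} with l < i. No subtraction is truncated, since
   kappa <= r for a minimal r. *)
Definition v_order (r : 'I_m -> nat) (l : 'I_m) : nat :=
  ((r l).+1 - kappa l)%N.
Definition lower_v_order (r : 'I_m -> nat) (j l : 'I_m) : nat :=
  if (blk l < blk j)%N then (r l - kappa l)%N else 0%N.

(* vphi j a is the function phi^j_[a], a < kappa^j, of (zeta, x) and the
   shifts of the v_l of lower blocks. *)
Definition lower_shifts (r : 'I_m -> nat)
    (vphi : forall j, nat ->
       'M[R]_(q, m) * 'rV[R]_n * jetspace (lower_v_order r j) -> R) : Prop :=
  forall j a, (a < kappa j)%N ->
    smooth_near (eq_past, x0, jet (lower_v_order r j) (fun=> eq_output))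
      (vphi j a) /\
    \forall z \near traj_nbhs eq_traj,
      shifted_output a z ord0 j =
      vphi j a (past z, state z, jet (lower_v_order r j) (inp (coords s z))).

Definition phi_map (r : 'I_m -> nat)
    (vphi : forall j, nat ->
       'M[R]_(q, m) * 'rV[R]_n * jetspace (lower_v_order r j) -> R)
    (c : 'M[R]_(q, m) * 'rV[R]_n * jetspace (v_order r)) :
    jetspace (fun j => (r j).+1) :=
  let: (Z, x, V) := c in
  jet (fun j => (r j).+1) (fun a => \row_j
    (if (a < kappa j)%N
     then vphi j a (Z, x, jet (lower_v_order r j) (unjet V))
     else unjet V (a - kappa j) ord0 j)).

(* u = F_u o phi(zeta_[-q,-1], x, v_[0,r-kappa]), with v stored in [inp]. *)
Definition linearizing_feedback (r : 'I_m -> nat)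
    (Fu : jetspace (fun j => (r j).+1) -> 'rV[R]_m)
    (vphi : forall j, nat ->
       'M[R]_(q, m) * 'rV[R]_n * jetspace (lower_v_order r j) -> R)
    (c : traj) : 'rV[R]_m :=
  Fu (phi_map vphi (past c, state c, jet (v_order r) (inp c))).

End Procedure.
End System.
End Trajectories.

Arguments traj : clear implicits.

(* Main.v *)
Require Import Defs.
From HB Require Import structures.
From mathcomp Require Import all_boot all_order all_algebra all_fingroup.
From mathcomp Require Import all_classical all_reals all_analysis.
From mathcomp Require Import ring.
Import Order.TTheory GRing.Theory Num.Theory numFieldNormedType.Exports.

Local Open Scope classical_set_scope.
Local Open Scope ring_scope.

(** The proof compares the closed loop with open-loop trajectories of the system.

    An open-loop trajectory near the equilibrium has coordinates
    [(zeta, x, v)], where [v] collects the output shifts [y_[kappa]]. By the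
    definition of the functions [vphi], the map [phi_map] recovers all the
    shifts [y_[0,r]] from these coordinates, and flatness then recovers the
    input: the feedback evaluated at the coordinates of a trajectory is the
    first input of that trajectory. Hence the closed loop started at these
    coordinates follows the trajectory ([closed_loop_follows]), and its output
    satisfies [y_[kappa] = v] because this is how [v] was read off.

    What has to be shown is that every [(zeta, x, v)] near the equilibrium
    value consists of the coordinates of some open-loop trajectory
    ([coords_open]). This is the openness of a submersion ([sdiff_open]), a
    consequence of the contraction principle, so only the derivative of the
    coordinates at the equilibrium has to be shown to be onto. Differentiating
    at the equilibrium turns the system, its outputs and the procedure into
    linear ones, given by the same formulas. For the linear procedure the claim
    is proved one step at a time ([onto_step]): given the past, the state and
    the shifts of [v_1, ..., v_i], the output shifts selected in step [i + 1]
    depend on the remaining inputs in a way that is triangular in time, and the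
    diagonal blocks are the invertible matrix that defines the step.

    A trajectory has infinitely many inputs, so derivatives are taken in a space
    topologized by the norms of its finite windows. The notion that composes
    well and suffices for the contraction argument is strict differentiability
    ([sdiff]); smooth functions on finite-dimensional spaces have it by the mean
    value theorem.

    If the flat output does not involve [zeta], neither do its shifts, and two
    trajectories that differ only in the past have the same outputs; with
    [coords_open] this shows that [phi_map] does not depend on [zeta]. For
    [#kappa = n], consider the linearized outputs [y^j_[a]], [a < kappa^j],
    on trajectories with [v = 0]. They are a linear function of [x], which is
    injective because flatness expresses [x] by the outputs. It is also onto:
    a linear relation among these outputs, applied after sufficiently many
    shifts, becomes a relation among entries of [v], and these are free. *)

Set Implicit Arguments.
Unset Strict Implicit.

(** * Finite-dimensional normed spaces *)

Definition linear_pack (R : pzRingType) (X Y : lmodType R) (f : X -> Y)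
    (fl : linear f) : {linear X -> Y} :=
  HB.pack_for {linear X -> Y} f (GRing.isLinear.Build R X Y *:%R f fl).

Section Finite_dimension.
Context {R : realType}.

Lemma norm_mx_le a b (A : 'M[R]_(a, b)) (c : R) : 0 <= c ->
  (forall i j, `|A i j| <= c) -> `|A| <= c.
Proof.
move=> c0 Ac; rewrite /Num.norm /= mx_normrE.
by apply: bigmax_le => // -[i j] _; exact: Ac.
Qed.

Lemma norm_mx_entry a b (A : 'M[R]_(a, b)) i j : `|A i j| <= `|A|.
Proof. by rewrite [leRHS]/Num.norm /= mx_normrE; apply: (le_bigmax _ _ (i, j)). Qed.

(** Encoded by linear coordinates with a bound, which products of matrix spaces
    have explicitly. *)
Definition findim (V : normedModType R) := exists d
    (s : {linear 'rV[R]_d -> V}) (c : {linear V -> 'rV[R]_d}) (K : R),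
  [/\ cancel s c, cancel c s, 0 <= K & forall v, `|c v| <= K * `|v|].

Lemma findim_mx a b : findim 'M[R]_(a, b).
Proof.
exists (a * b)%N, vec_mx, mxvec, 1.
split => //; [exact: vec_mxK | exact: mxvecK | move=> A].
rewrite mul1r; apply: norm_mx_le => // i k; rewrite (ord1 i).
by case/mxvec_indexP: k => k l; rewrite mxvecE norm_mx_entry.
Qed.

Lemma findim_prod (V W : normedModType R) :
  findim V -> findim W -> findim (V * W)%type.
Proof.
move=> [d [s [c [K [sK cK K0 cb]]]]] [d' [s' [c' [K' [sK' cK' K'0 cb']]]]].
have Sl : linear (fun w : 'rV[R]_(d + d') => (s (lsubmx w), s' (rsubmx w))).
  by move=> t u v /=; rewrite !linearP.
have Cl : linear (fun v : V * W => row_mx (c v.1) (c' v.2)).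
  by move=> t u v /=; rewrite !linearP /= scale_row_mx add_row_mx.
exists (d + d')%N, (linear_pack Sl), (linear_pack Cl), (K + K'); split.
- by move=> w; rewrite /= sK sK' hsubmxK.
- by move=> v; rewrite /= row_mxKl row_mxKr cK cK'; case: v.
- exact: addr_ge0.
move=> v /=; apply: norm_mx_le => [|i j]; first by rewrite mulr_ge0 ?addr_ge0.
have v1 : `|v.1| <= `|v| by rewrite prod_normE le_max lexx.
have v2 : `|v.2| <= `|v| by rewrite prod_normE le_max lexx orbT.
rewrite mxE mulrDl; case: splitP => k _.
- rewrite (le_trans (norm_mx_entry _ _ _))// (le_trans (cb _))//.
  by rewrite ler_wpDr ?mulr_ge0// ler_wpM2l.
- rewrite (le_trans (norm_mx_entry _ _ _))// (le_trans (cb' _))//.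
  by rewrite ler_wpDl ?mulr_ge0// ler_wpM2l.
Qed.

Lemma findim_linear (V W : normedModType R) d (s : {linear 'rV[R]_d -> V})
    (c : {linear V -> 'rV[R]_d}) (L : {linear V -> W}) v :
  cancel c s -> L v = \sum_i c v ord0 i *: L (s (delta_mx ord0 i)).
Proof.
move=> cK; rewrite -{1}[v]cK [c v in LHS]row_sum_delta !linear_sum.
by apply: eq_bigr => i _; rewrite !linearZ.
Qed.

Lemma findim_bounded (V W : normedModType R) (L : {linear V -> W}) :
  findim V -> exists2 C : R, 0 <= C & forall v, `|L v| <= C * `|v|.
Proof.
move=> [d [s [c [K [_ cK K0 cb]]]]].
exists (\sum_i K * `|L (s (delta_mx ord0 i))|).
  by apply: sumr_ge0 => i _; rewrite mulr_ge0.
move=> v; rewrite (findim_linear L v cK) (le_trans (ler_norm_sum _ _ _))//.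
rewrite mulr_suml; apply: ler_sum => i _.
rewrite normrZ mulrAC ler_wpM2r//.
by rewrite (le_trans (norm_mx_entry _ _ _))// cb.
Qed.

End Finite_dimension.

(** * Strict differentiability of smooth maps *)

Section Strict.
Context {R : realType} {V W : normedModType R}.
Implicit Types (h : V -> W) (p : V).

Lemma smooth_near_C1 p h : smooth_near p h ->
  (\forall z \near p, differentiable h z) /\
  forall d, differentiable ('D_d h) p.
Proof.
move=> hs; split; first by apply: filterS hs => z /(_ [::]).
by move=> d; have /(_ [:: d]) := nbhs_singleton hs.
Qed.

Lemma near_ball_norm p (P : V -> Prop) : (\forall z \near p, P z) <->
  exists2 d : R, 0 < d & forall z, `|z - p| < d -> P z.
Proof.
split=> [/nbhs_ballP[d d0 dP]|[d d0 dP]].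
  exists d => // z zd; apply: dP; rewrite -ball_normE /ball_ /=.
  by rewrite distrC.
by apply/nbhs_ballP; exists d => // z; rewrite -ball_normE /ball_ /= distrC => /dP.
Qed.

(** Functionals [l] are applied to [h] because the mean value theorem, for which
    this lemma prepares, holds for scalar functions. *)
Lemma line_is_derive h p v (l : {linear W -> R}) (C : R) (t : R) :
  (forall w, `|l w| <= C * `|w|) ->
  differentiable h (p + t *: v) ->
  is_derive t 1 (fun u : R => l (h (p + u *: v))) (l ('D_v h (p + t *: v))).
Proof.
move=> lb hd.
have lc : continuous l.
  apply/linear_bounded_continuous/linear_boundedP.
  apply: filterS (nbhs_pinfty_ge (num_real C)) => r Cr w.
  by rewrite (le_trans (lb w))// ler_wpM2r.
have cl : (fun s : R => s^-1 *: (((fun u : R => l (h (p + u *: v))) \o shift t) (s *: 1)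
    - l (h (p + t *: v)))) @ 0^' --> l ('D_v h (p + t *: v)).
  have := @diff_derivable _ _ _ _ _ v hd; rewrite /derivable => hc.
  have := cvg_comp _ _ hc (lc _) => {}hc.
  apply: cvg_trans hc; apply: near_eq_cvg; near=> s => /=.
  rewrite linearZ linearB /=; congr (_ *: (l (h _) - _)).
  by rewrite [s%:A]mulr1 scalerDl addrCA.
split; first by apply/cvg_ex; eexists; exact: cl.
exact: cvg_lim cl.
Unshelve. all: by end_near. Qed.

(** The increment of [h] over a segment is controlled by the mean value theorem
    applied to a functional of [h], and the derivative along the segment is
    a combination, over a finite frame, of continuous partial derivatives. *)
Lemma C1_strict p h (l : {linear W -> R}) (C : R) : findim V ->
  smooth_near p h -> (forall w, `|l w| <= C * `|w|) ->
  forall e : R, 0 < e -> exists2 d : R, 0 < d & forall a b,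
    `|a - p| < d -> `|b - p| < d ->
    `|l (h a - h b - 'd h p (a - b))| <= e * `|a - b|.
Proof.
move=> [N [s [c [K [_ cK K0 cb]]]]] /smooth_near_C1[hd hdd] lb e e0.
pose ei i := s (delta_mx ord0 i).
have C0 : 0 <= `|C| by [].
pose M := `|C| * (K * N%:R) + 1.
have M0 : 0 < M by rewrite ltr_wpDl// !mulr_ge0.
have eM : 0 < e / M by rewrite divr_gt0.
have near1 : \forall z \near p, forall i, `|'D_(ei i) h z - 'D_(ei i) h p| < e / M.
  apply: filter_forall => i.
  have := differentiable_continuous (hdd (ei i)).
  move=> /cvgrPdist_lt /(_ _ eM); apply: filterS => z.
  by rewrite distrC.
have /near_ball_norm[d d0 dP] : \forall z \near p, differentiable h z /\
    forall i, `|'D_(ei i) h z - 'D_(ei i) h p| < e / M.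
  by apply: filterI.
exists d => // a b ad bd; pose v := a - b.
have inball (t : R) : 0 <= t <= 1 -> `|b + t *: v - p| < d.
  move=> /andP[t0 t1].
  have -> : b + t *: v - p = (1 - t) *: (b - p) + t *: (a - p).
    rewrite (_ : a - p = v + (b - p)); last by rewrite addrA subrK.
    rewrite [t *: (v + _)]scalerDr [RHS]addrCA.
    by rewrite -scalerDl subrK scale1r addrC addrAC.
  rewrite (le_lt_trans (ler_normD _ _))// !normrZ !ger0_norm ?subr_ge0//.
  have -> : d = (1 - t) * d + t * d by rewrite -mulrDl subrK mul1r.
  have [->|tn0] := eqVneq t 0; first by rewrite !mul0r !addr0 subr0 !mul1r.
  rewrite ler_ltD//; first by rewrite ler_wpM2l ?subr_ge0// ltW.
  by rewrite ltr_pM2l// lt0r tn0.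
pose F (t : R) := l (h (b + t *: v)).
have Fd (t : R) : 0 <= t <= 1 -> is_derive t 1 F (l ('D_v h (b + t *: v))).
  move=> t01; apply: line_is_derive lb _.
  by have [] := dP _ (inball _ t01).
have [| | |t t01 Fab] := @MVT R F (fun t => l ('D_v h (b + t *: v))) 0 1.
- exact: ltr01.
- by move=> t; rewrite in_itv /= => /andP[t0 t1]; apply: Fd; rewrite !ltW.
- apply: derivable_within_continuous => t; rewrite in_itv /= => /Fd tF.
  exact: ex_derive.
have {t01} t01 : 0 <= t <= 1 by move: t01; rewrite in_itv /= => /andP[? ?]; rewrite !ltW.
have [hz hD] := dP _ (inball _ t01).
have -> : l (h a - h b - 'd h p v) = l ('d h (b + t *: v) v - 'd h p v).
  rewrite -(deriveE v hz) [LHS]linearB [RHS]linearB /=; congr (_ - _).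
  move: Fab; rewrite subr0 mulr1 => <-.
  by rewrite /F scale1r scale0r addr0 [b + _]addrC subrK linearB.
have hp : differentiable h p by exact: nbhs_singleton hd.
rewrite (findim_linear ('d h p) v cK) (findim_linear ('d h _) v cK) -sumrB.
rewrite (le_trans (lb _))// (le_trans (ler_wpM2r (normr_ge0 _) (ler_norm C)))//.
rewrite (@le_trans _ _ (`|C| * (K * N%:R * `|v| * (e / M))))//.
  rewrite ler_wpM2l// (le_trans (ler_norm_sum _ _ _))//.
  rewrite (@le_trans _ _ (\sum_(i < N) (K * `|v| * (e / M))))//.
    apply: ler_sum => i _; rewrite -scalerBr normrZ ler_pM//.
      by rewrite (le_trans (norm_mx_entry _ _ _))// cb.
    by rewrite -!deriveE// ltW// hD.
  rewrite sumr_const card_ord -[leLHS]mulr_natl.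
  by rewrite [leLHS](_ : _ = K * N%:R * `|v| * (e / M)) //; ring.
rewrite (_ : _ * _ = (M - 1) / M * e * `|v|); last first.
  by rewrite /M addrK; ring.
rewrite ler_wpM2r// ler_piMl ?(ltW e0)//.
by rewrite ler_pdivrMr// mul1r gerBl.
Qed.

End Strict.

(** * Calculus in spaces topologized by a sequence of seminorms *)

Section Seminorms.
Context {R : realType}.

(** Trajectories have infinitely many inputs, and local statements about them
    restrict only finitely many: the relevant topology is given by the norms of
    the windows, an increasing sequence of seminorms. *)
Record seminorms (X : lmodType R) (p : nat -> X -> R) : Prop := Seminorms {
  sn_mono : forall M N x, (M <= N)%N -> p M x <= p N x;
  snD : forall N x y, p N (x + y) <= p N x + p N y;
  snZ : forall N a x, p N (a *: x) = `|a| * p N x }.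

(** A normed space, seen as a space with a constant sequence of seminorms. *)
Definition nrm (V : normedModType R) (N : nat) (v : V) : R := `|v|.

Lemma nrm_sn (V : normedModType R) : seminorms (nrm (V := V)).
Proof.
by split=> [M N x _|N x y|N a x]; rewrite /nrm ?lexx ?ler_normD ?normrZ.
Qed.

Section Seminorms_theory.
Context {X : lmodType R} {p : nat -> X -> R} (pS : seminorms p).

Lemma sn0 N : p N 0 = 0.
Proof. by rewrite -(scale0r 0) (snZ pS) normr0 mul0r. Qed.

Lemma snN N x : p N (- x) = p N x.
Proof. by rewrite -scaleN1r (snZ pS) normrN normr1 mul1r. Qed.

Lemma sn_ge0 N x : 0 <= p N x.
Proof.
rewrite -(@pmulr_lge0 _ 2)// mulr_natr mulr2n -{2}snN.
by rewrite (le_trans _ (snD pS _ _ _))// subrr sn0.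
Qed.

End Seminorms_theory.

Definition near_sn (X : lmodType R) (p : nat -> X -> R) (x : X) (P : X -> Prop) :=
  exists (N : nat) (d : R), 0 < d /\ forall a, p N (a - x) < d -> P a.

Lemma near_snI (X : lmodType R) (p : nat -> X -> R) x P Q : seminorms p ->
  near_sn p x P -> near_sn p x Q -> near_sn p x (fun a => P a /\ Q a).
Proof.
move=> pS [N [d [d0 dP]]] [N' [d' [d'0 dQ]]].
exists (maxn N N'), (Num.min d d'); split=> [|a]; first by rewrite lt_min d0.
rewrite lt_min => /andP[ad ad']; split; [apply: dP|apply: dQ].
  by apply: le_lt_trans ad; rewrite (sn_mono pS)// leq_maxl.
by apply: le_lt_trans ad'; rewrite (sn_mono pS)// leq_maxr.
Qed.

Lemma near_snW (X : lmodType R) (p : nat -> X -> R) x (P Q : X -> Prop) :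
  (forall a, P a -> Q a) -> near_sn p x P -> near_sn p x Q.
Proof. by move=> PQ [N [d [d0 dP]]]; exists N, d; split=> // a /dP/PQ. Qed.

Lemma near_sn_true (X : lmodType R) (p : nat -> X -> R) x (P : X -> Prop) :
  (forall a, P a) -> near_sn p x P.
Proof. by move=> aP; exists 0%N, 1; split. Qed.

Lemma near_sn_at (X : lmodType R) (p : nat -> X -> R) x (P : X -> Prop) :
  seminorms p -> near_sn p x P -> P x.
Proof. by move=> pS [N [d [d0 dP]]]; apply: dP; rewrite subrr (sn0 pS). Qed.

Lemma near_sn_all (X : lmodType R) (p : nat -> X -> R) x (I : finType)
    (P : I -> X -> Prop) : seminorms p ->
  (forall i, near_sn p x (P i)) -> near_sn p x (fun a => forall i, P i a).
Proof.
move=> pS iP.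
suff: near_sn p x (fun a => forall i, i \in enum I -> P i a).
  by apply: near_snW => a aP i; apply: aP; rewrite mem_enum.
elim: (enum I) => [|i s IH]; first exact: near_sn_true.
apply: near_snW (near_snI pS (iP i) IH) => a [Pi Ps] k.
by rewrite inE => /predU1P[->//|/Ps].
Qed.

(** Strict differentiability: the approximation of [f a - f b] by [L (a - b)] is
    uniform in both points [a] and [b] near [x], which makes [f] minus [L] a
    contraction in small neighborhoods. *)
Definition sdiff (X Y : lmodType R) (p : nat -> X -> R) (q : nat -> Y -> R)
    (x : X) (f : X -> Y) (L : {linear X -> Y}) : Prop :=
  forall M, exists (N : nat) (C : R), [/\ 0 <= C,
    forall h, q M (L h) <= C * p N h &
    forall e : R, 0 < e -> exists2 d : R, 0 < d & forall a b,
      p N (a - x) < d -> p N (b - x) < d ->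
      q M (f a - f b - L (a - b)) <= e * p N (a - b)].

Section Strict_calculus.
Context {X Y Z : lmodType R}.
Context {p : nat -> X -> R} {q : nat -> Y -> R} {r : nat -> Z -> R}.
Context (pS : seminorms p) (qS : seminorms q) (rS : seminorms r).

Lemma sdiff_lipschitz x f (L : {linear X -> Y}) : sdiff p q x f L ->
  forall M, exists N (C d : R), [/\ 0 < C, 0 < d & forall a b,
    p N (a - x) < d -> p N (b - x) < d -> q M (f a - f b) <= C * p N (a - b)].
Proof.
move=> fL M; have [N [C [C0 LC /(_ 1 ltr01)[d d0 dP]]]] := fL M.
exists N, (C + 1), d; split=> // [|a b ad bd]; first exact: ltr_wpDl.
rewrite -[f a - f b](subrK (L (a - b))) mulrDl addrC.
by rewrite (le_trans (snD qS _ _ _))// lerD// dP.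
Qed.

Lemma sdiff_near x f (L : {linear X -> Y}) (P : Y -> Prop) :
  sdiff p q x f L -> near_sn q (f x) P -> near_sn p x (P \o f).
Proof.
move=> fL [M [e [e0 eP]]].
have [N [C [d [C0 d0 dP]]]] := sdiff_lipschitz fL M.
exists N, (Num.min d (e / C)); split=> [|a]; first by rewrite lt_min d0 divr_gt0.
rewrite lt_min => /andP[ad ae]; apply: eP.
rewrite (le_lt_trans (dP _ _ ad _))// ?subrr ?(sn0 pS)//.
by rewrite mulrC -ltr_pdivlMr.
Qed.

Lemma sdiff_eq x f g (L : {linear X -> Y}) :
  near_sn p x (fun a => f a = g a) -> sdiff p q x f L -> sdiff p q x g L.
Proof.
move=> [N' [d' [d'0 fg]]] fL M; have [N [C [C0 LC dP]]] := fL M.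
exists (maxn N N'), C; split=> // [h|e e0].
  by rewrite (le_trans (LC h))// ler_wpM2l// (sn_mono pS)// leq_maxl.
have [d d0 {}dP] := dP _ e0; exists (Num.min d d'); first by rewrite lt_min d0.
have Nl a : p N a <= p (maxn N N') a by rewrite (sn_mono pS)// leq_maxl.
have Nr a : p N' a <= p (maxn N N') a by rewrite (sn_mono pS)// leq_maxr.
move=> a b; rewrite !lt_min => /andP[ad ad'] /andP[bd bd'].
rewrite -!fg; [|exact: le_lt_trans bd'|exact: le_lt_trans ad'].
rewrite (le_trans (dP _ _ _ _)) ?(le_lt_trans (Nl _))//.
by rewrite ler_wpM2l// ltW.
Qed.

Lemma sdiff_linear x (L : {linear X -> Y}) :
  (forall M, exists N (C : R), 0 <= C /\ forall h, q M (L h) <= C * p N h) ->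
  sdiff p q x L L.
Proof.
move=> Lb M; have [N [C [C0 LC]]] := Lb M; exists N, C; split=> // e e0.
exists 1 => // a b _ _; rewrite linearB subrr (sn0 qS).
by rewrite mulr_ge0 ?(sn_ge0 pS)// ltW.
Qed.

Lemma sdiff_comp x f g (L : {linear X -> Y}) (L' : {linear Y -> Z}) :
  sdiff p q x f L -> sdiff q r (f x) g L' -> sdiff p r x (g \o f) (L' \o L).
Proof.
move=> fL gL M; have [N' [C' [C'0 LC' dP']]] := gL M.
have [N [C [C0 LC dP]]] := fL N'.
exists N, (C' * C); split=> [|h|e e0]; first exact: mulr_ge0.
  by rewrite /= (le_trans (LC' _))// -mulrA ler_wpM2l.
pose e1 := e / (2 * (C' + 1)).
have e10 : 0 < e1 by rewrite divr_gt0// mulr_gt0// ltr_wpDl.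
pose e2 := e / (2 * (C + e1)).
have e20 : 0 < e2 by rewrite divr_gt0// mulr_gt0// ltr_wpDl.
have [d1 d10 {}dP] := dP _ e10; have [d2 d20 {}dP'] := dP' _ e20.
have lip a b : p N (a - x) < d1 -> p N (b - x) < d1 ->
    q N' (f a - f b) <= (C + e1) * p N (a - b).
  move=> ad bd; rewrite -[f a - f b](subrK (L (a - b))) mulrDl addrC.
  by rewrite (le_trans (snD qS _ _ _))// lerD// dP.
have inball a : p N (a - x) < Num.min d1 (d2 / (C + e1)) ->
    p N (a - x) < d1 /\ q N' (f a - f x) < d2.
  rewrite lt_min => /andP[ad ad']; split=> //.
  rewrite (le_lt_trans (lip _ _ ad _)) ?subrr ?(sn0 pS)//.
  by rewrite mulrC -ltr_pdivlMr// ltr_wpDl.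
exists (Num.min d1 (d2 / (C + e1))).
  by rewrite lt_min d10 divr_gt0// ltr_wpDl.
move=> a b /inball[ad fad] /inball[bd fbd] /=.
have -> : g (f a) - g (f b) - L' (L (a - b)) =
    (g (f a) - g (f b) - L' (f a - f b)) + L' (f a - f b - L (a - b)).
  by rewrite [L' (_ - L _)]linearB addrA subrK.
rewrite (le_trans (snD rS _ _ _))// [e]splitr mulrDl lerD//.
  rewrite (le_trans (dP' _ _ fad fbd))//.
  rewrite (le_trans (ler_wpM2l (ltW e20) (lip _ _ ad bd)))// mulrA.
  rewrite ler_wpM2r ?(sn_ge0 pS)// /e2 invfM mulrA mulfVK//.
  by rewrite gt_eqF// ltr_wpDl.
rewrite (le_trans (LC' _))// (le_trans (ler_wpM2l C'0 (dP _ _ ad bd)))//.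
rewrite mulrA ler_wpM2r ?(sn_ge0 pS)// /e1 invfM.
rewrite [leLHS](_ : _ = e / 2 * (C' / (C' + 1))); last by ring.
rewrite ler_piMr//.
  by rewrite divr_ge0// ltW.
by rewrite ler_pdivrMr ?mul1r ?lerDl// ltr_wpDl.
Qed.

End Strict_calculus.

Lemma sdiff_extL (X Y : lmodType R) (p : nat -> X -> R) (q : nat -> Y -> R)
    x f (L L' : {linear X -> Y}) : L =1 L' -> sdiff p q x f L -> sdiff p q x f L'.
Proof.
move=> LL' fL M; have [N [C [C0 LC dP]]] := fL M.
exists N, C; split=> // [h|e /dP[d d0 {}dP]]; first by rewrite -LL'.
by exists d => // a b; rewrite -LL'; exact: dP.
Qed.

(** Strict differentiability of a scalar function, with a derivative given
    as a plain function. *)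
Definition rdiff (X : lmodType R) (p : nat -> X -> R) (x : X) (h l : X -> R) :=
  exists2 l' : {linear X -> R}, l' =1 l & sdiff p (nrm (V := R)) x h l'.

(** Each seminorm of the target being controlled by finitely many scalar
    coordinates, strict differentiability can be tested on coordinates. *)
Lemma sdiff_coords (X Y : lmodType R) (p : nat -> X -> R) (q : nat -> Y -> R)
    x (f : X -> Y) (L : {linear X -> Y}) : seminorms p ->
  (forall M, exists (I : finType) (pi : I -> Y -> R),
    [/\ forall i u v, pi i (u - v) = pi i u - pi i v,
        forall c v, 0 <= c -> (forall i, `|pi i v| <= c) -> q M v <= c &
        forall i, rdiff p x (pi i \o f) (pi i \o L)]) ->
  sdiff p q x f L.
Proof.
move=> pS fl M; have [I [pi [piB qM {}fl]]] := fl M.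
have fl' j : exists NC : nat * R, 0 <= NC.2 /\
    (forall h, `|pi j (L h)| <= NC.2 * p NC.1 h) /\
    forall e : R, 0 < e -> exists2 d : R, 0 < d & forall a b,
      p NC.1 (a - x) < d -> p NC.1 (b - x) < d ->
      `|pi j (f a - f b - L (a - b))| <= e * p NC.1 (a - b).
  have [l lL /(_ 0%N)[N [C [C0 LC dP]]]] := fl j.
  exists (N, C); split=> //; split=> [h|e e0].
    by rewrite -[pi j _]/((pi j \o L) h) -lL LC.
  have [d d0 {}dP] := dP _ e0; exists d => // a b.
  by rewrite !piB -[pi j (L _)]/((pi j \o L) _) -lL; apply: dP.
have [NC NCP] := choice fl'.
pose N := \max_j (NC j).1; pose C := \sum_j (NC j).2.
have Np j h : p (NC j).1 h <= p N h by rewrite (sn_mono pS)// /N leq_bigmax.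
have C0 : 0 <= C by apply: sumr_ge0 => j _; have [] := NCP j.
exists N, C; split=> // [h|e e0].
  apply: qM => [|j]; first by rewrite mulr_ge0 ?(sn_ge0 pS).
  have [C'0 [LC _]] := NCP j; rewrite (le_trans (LC h))//.
  rewrite ler_pM ?(sn_ge0 pS)// /C (bigD1 j)//= lerDl.
  by apply: sumr_ge0 => k _; have [] := NCP k.
have fd j : exists d : R, 0 < d /\ forall a b,
    p N (a - x) < d -> p N (b - x) < d ->
    `|pi j (f a - f b - L (a - b))| <= e * p N (a - b).
  have [_ [_ /(_ _ e0)[d d0 dP]]] := NCP j; exists d; split=> // a b ad bd.
  rewrite (le_trans (dP _ _ _ _)) ?(le_lt_trans (Np _ _))//.
  by rewrite ler_wpM2l// ltW.
have [d dP] := choice fd.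
exists (\big[Num.min/1]_j d j).
  by apply: lt_bigmin => // j _; have [] := dP j.
move=> a b ad bd; apply: qM => [|j].
  by rewrite mulr_ge0 ?(sn_ge0 pS)// ltW.
have [_] := dP j; apply.
  by rewrite (lt_le_trans ad)// bigmin_le_cond.
by rewrite (lt_le_trans bd)// bigmin_le_cond.
Qed.

Lemma sdiff_row (X : lmodType R) (p : nat -> X -> R) (m : nat) x
    (f : X -> 'rV[R]_m) (L : {linear X -> 'rV[R]_m}) : seminorms p ->
  (forall j, rdiff p x (fun a => f a ord0 j) (fun h => L h ord0 j)) ->
  sdiff p (nrm (V := 'rV[R]_m)) x f L.
Proof.
move=> pS fl; apply: sdiff_coords => // M.
exists 'I_m, (fun j (v : 'rV[R]_m) => v ord0 j); split=> // [j u v|c v c0 vc].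
  by rewrite !mxE.
by apply: norm_mx_le => // i j; rewrite (ord1 i).
Qed.

Lemma rdiff_comp (X Y : lmodType R) (p : nat -> X -> R) (q : nat -> Y -> R)
    x f (L : {linear X -> Y}) h l : seminorms p -> seminorms q ->
  sdiff p q x f L -> rdiff q (f x) h l -> rdiff p x (h \o f) (l \o L).
Proof.
move=> pS qS fL [l' ll' hl]; exists (l' \o L) => [v|]; first by rewrite /= ll'.
exact: (sdiff_comp pS qS (nrm_sn R) fL hl).
Qed.

Lemma rdiff_ext (X : lmodType R) (p : nat -> X -> R) x h h' l l' :
  h =1 h' -> l =1 l' -> rdiff p x h l -> rdiff p x h' l'.
Proof. by move=> /funext-> /funext->. Qed.

Lemma rdiff_linear (X : lmodType R) (p : nat -> X -> R) x (l : X -> R) N :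
  linear l -> seminorms p -> (forall h, `|l h| <= p N h) -> rdiff p x l l.
Proof.
move=> ll pS lb; exists (linear_pack ll) => //.
apply: (@sdiff_linear X R p _ pS (nrm_sn R) x (linear_pack ll)) => M.
by exists N, 1; split=> // h; rewrite mul1r /nrm lb.
Qed.

Lemma entry_linear a b i j : linear (fun v : 'M[R]_(a, b) => v i j : R).
Proof. by move=> t u v; rewrite !mxE. Qed.

Lemma rdiff_entry a b (X : lmodType R) (p : nat -> X -> R) x f
    (L : {linear X -> 'M[R]_(a, b)}) i j : seminorms p ->
  sdiff p (nrm (V := 'M[R]_(a, b))) x f L ->
  rdiff p x (fun z => f z i j) (fun h => L h i j).
Proof.
move=> pS fL; have el : rdiff (nrm (V := 'M[R]_(a, b))) (f x) (fun v => v i j) (fun v => v i j).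
  apply: (@rdiff_linear _ _ _ _ 0%N (@entry_linear a b i j) (nrm_sn _)) => h.
  exact: norm_mx_entry.
exact: (rdiff_comp pS (nrm_sn _) fL el).
Qed.

Lemma smooth_sdiff (V : normedModType R) (p : V) (h : V -> R) :
  findim V -> smooth_near p h ->
  sdiff (nrm (V := V)) (nrm (V := R)) p h ('d h p).
Proof.
move=> Vf hs M; have [C C0 CP] := findim_bounded ('d h p) Vf.
exists 0%N, C; split=> //.
have := @C1_strict R V R p h idfun 1 Vf hs; apply => w.
by rewrite mul1r.
Qed.

Lemma smooth_sdiff_row m (V : normedModType R) (p : V) (h : V -> 'rV[R]_m) :
  findim V -> smooth_near p h ->
  sdiff (nrm (V := V)) (nrm (V := 'rV[R]_m)) p h ('d h p).
Proof.
move=> Vf hs; apply: sdiff_row => [|j]; first exact: nrm_sn.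
pose l := linear_pack (@entry_linear 1 m ord0 j).
exists (l \o 'd h p) => // M.
have lb w : `|l w| <= 1 * `|w| by rewrite mul1r norm_mx_entry.
have [C C0 CP] := findim_bounded ('d h p) Vf.
exists 0%N, C; split=> // [v|e e0].
  by rewrite (le_trans _ (CP v))// -[leRHS]mul1r lb.
have [d d0 dP] := C1_strict Vf hs lb e0; exists d => // a b ad bd.
by have := dP a b ad bd; rewrite /nrm /l /= !mxE.
Qed.

(** Derivatives along a line have a single value, and strict derivatives as well
    as differentials of functions on normed spaces are determined by them: they
    serve to identify derivatives obtained in different ways. *)
Definition line_deriv (X : lmodType R) (V : normedModType R) (f : X -> V)
    (x h : X) (D : V) := forall e : R, 0 < e -> exists2 d : R, 0 < d &
  forall t : R, 0 < t < d -> `|f (x + t *: h) - f x - t *: D| <= e * t.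

Lemma line_deriv_unique (X : lmodType R) (V : normedModType R) (f : X -> V)
    (x h : X) (D D' : V) : line_deriv f x h D -> line_deriv f x h D' -> D = D'.
Proof.
move=> fD fD'; apply/eqP; rewrite -subr_eq0 -normr_le0; apply/ler_addgt0Pl => e e0.
have e20 : 0 < e / 2 by rewrite divr_gt0.
have [d d0 dP] := fD _ e20; have [d' d'0 dP'] := fD' _ e20.
pose t := Num.min d d' / 2.
have m0 : 0 < Num.min d d' by rewrite lt_min d0.
have t0 : 0 < t by rewrite divr_gt0.
have tm : t < Num.min d d' by rewrite /t ltr_pdivrMr// ltr_pMr// ltr1n.
have /dP {}dP : 0 < t < d by rewrite t0 (lt_le_trans tm)// ge_min lexx.
have /dP' {}dP' : 0 < t < d' by rewrite t0 (lt_le_trans tm)// ge_min lexx orbT.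
rewrite addr0 -(ler_pM2r t0) -{1}(gtr0_norm t0) mulrC -normrZ.
rewrite [e]splitr mulrDl; apply: le_trans (lerD dP' dP).
rewrite (_ : t *: (D - D') = f (x + t *: h) - f x - t *: D' -
  (f (x + t *: h) - f x - t *: D)) ?ler_normB//.
by rewrite scalerBr opprB [RHS]addrC addrA subrK.
Qed.

Lemma sdiff_line (X : lmodType R) (V : normedModType R) (p : nat -> X -> R)
    x f (L : {linear X -> V}) h : seminorms p ->
  sdiff p (nrm (V := V)) x f L -> line_deriv f x h (L h).
Proof.
move=> pS fL e e0; have [N [C [_ _ dP]]] := fL 0%N.
have P0 : 0 < p N h + 1 by rewrite ltr_wpDl// (sn_ge0 pS).
have [|d d0 {}dP] := dP (e / (p N h + 1)); first exact: divr_gt0.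
exists (d / (p N h + 1)); first exact: divr_gt0.
move=> t /andP[t0 td].
have E : x + t *: h - x = t *: h by rewrite addrC addKr.
have := dP (x + t *: h) x; rewrite subrr (sn0 pS) E (snZ pS) gtr0_norm//.
rewrite /nrm linearZ => /(_ _ d0) dP1; apply: le_trans (dP1 _) _.
  have tp : t * p N h <= t * (p N h + 1) by rewrite ler_wpM2l ?lerDl// ltW.
  by rewrite (le_lt_trans tp)// -ltr_pdivlMr.
rewrite mulrAC ler_pdivrMr// mulrAC -!mulrA ler_wpM2l ?(ltW e0)//.
by rewrite [leRHS]mulrC ler_wpM2l ?lerDl// ltW.
Qed.

Lemma line_deriv_eq (X : lmodType R) (V : normedModType R) (p : nat -> X -> R)
    x (f g : X -> V) h D : seminorms p ->
  near_sn p x (fun a => f a = g a) -> line_deriv f x h D -> line_deriv g x h D.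
Proof.
move=> pS [N [d [d0 fg]]] fD e e0; have [d' d'0 dP] := fD _ e0.
have P0 : 0 < p N h + 1 by rewrite ltr_wpDl// (sn_ge0 pS).
exists (Num.min d' (d / (p N h + 1))); first by rewrite lt_min d'0 divr_gt0.
move=> t /andP[t0]; rewrite lt_min => /andP[td' td].
rewrite -!fg ?subrr ?(sn0 pS)//; first by apply: dP; rewrite t0.
rewrite [x + _]addrC addrK (snZ pS) gtr0_norm//.
have tp : t * p N h <= t * (p N h + 1) by rewrite ler_wpM2l ?lerDl// ltW.
by rewrite (le_lt_trans tp)// -ltr_pdivlMr.
Qed.

Lemma sdiff_unique (X : lmodType R) (V : normedModType R) (p : nat -> X -> R)
    x (f g : X -> V) (L L' : {linear X -> V}) : seminorms p ->
  near_sn p x (fun a => f a = g a) ->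
  sdiff p (nrm (V := V)) x f L -> sdiff p (nrm (V := V)) x g L' -> L =1 L'.
Proof.
move=> pS fg fL gL h; apply: (@line_deriv_unique X V g x h).
  by apply: (line_deriv_eq pS fg); exact: (sdiff_line _ pS fL).
exact: (sdiff_line _ pS gL).
Qed.

End Seminorms.

(** * Openness of submersions *)

HB.instance Definition _ (R : realType) (a b : nat) :=
  Complete.copy 'M[R]_(a, b) 'M[R]_(a, b).

Section Openness.
Context {R : realType}.

(** The bound on [G 0] keeps the iterates of [G] in the ball of radius [rho]. *)
Lemma contraction_ball (d : nat) (G : 'rV[R]_d -> 'rV[R]_d) (rho : R) :
  0 < rho -> `|G 0| <= rho / 2 ->
  (forall w w', `|w| <= rho -> `|w'| <= rho ->
    `|G w - G w'| <= 1 / 2 * `|w - w'|) ->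
  exists2 w, `|w| <= rho & G w = w.
Proof.
move=> rho0 G0 Gl; pose U := closed_ball (0 : 'rV[R]_d) rho.
have UE w : U w <-> `|w| <= rho.
  by rewrite /U closed_ballE// /closed_ball_ /= sub0r normrN.
have GU : {homo G : w / U w >-> U w}.
  move=> w /UE wU; apply/UE; rewrite -[G w](subrK (G 0)).
  rewrite (le_trans (ler_normD _ _))// [rho]splitr lerD//.
  rewrite (le_trans (Gl _ _ wU _)) ?normr0 ?(ltW rho0)// subr0.
  by rewrite mul1r mulrC ler_pM2r// invr_gt0.
have [|||w /UE wU wG] := @banach_fixed_point R _ U [fun of mkfun GU].
- exists (1 / 2)%:nng; split=> /=; first by rewrite ltr_pdivrMr ?mul1r ?ltr1n.
  by move=> [w w'] [/= /UE wU /UE w'U]; exact: Gl.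
- exact: closed_ball_closed.
- by exists 0; apply/UE; rewrite normr0 ltW.
- by exists w.
Qed.

(** If the derivative is onto, the equation [f a = y] is solved by a Newton
    iteration along a finite-dimensional complement of its kernel. *)
Lemma sdiff_open (X : lmodType R) (p : nat -> X -> R) (V : normedModType R)
    x (f : X -> V) (L : {linear X -> V}) (P : X -> Prop) :
  seminorms p -> findim V -> sdiff p (nrm (V := V)) x f L ->
  (forall v, exists h, L h = v) -> near_sn p x P ->
  near_sn (nrm (V := V)) (f x) (fun y => exists2 a, P a & f a = y).
Proof.
move=> pS [d [s [c [K [sK cK K0 cb]]]]] fL Ls [N' [d2 [d20 dP]]].
(* [B] is a right inverse of [L], in the coordinates [s], [c] of [V] *)
have [z zP] := choice (fun i : 'I_d => Ls (s (delta_mx ord0 i))).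
pose B (w : 'rV[R]_d) := \sum_i w ord0 i *: z i.
have LB w : L (B w) = s w.
  rewrite /B linear_sum {2}[w]row_sum_delta linear_sum; apply: eq_bigr => i _.
  by rewrite !linearZ /= zP.
pose A M := \sum_i p M (z i) + 1.
have A0 M : 0 < A M.
  by rewrite ltr_wpDl//; apply: sumr_ge0 => i _; rewrite (sn_ge0 pS).
have BB w w' : B w - B w' = B (w - w').
  by rewrite /B -sumrB; apply: eq_bigr => i _; rewrite !mxE scalerBl.
have pB M w : p M (B w) <= A M * `|w|.
  rewrite (@le_trans _ _ (\sum_i p M (w ord0 i *: z i)))//.
    rewrite /B; elim/big_ind2: _ => [|a b a' b' aa bb|//]; first by rewrite (sn0 pS).
    by rewrite (le_trans (snD pS _ _ _))// lerD.
  rewrite mulrDl ler_wpDr ?mul1r// mulr_suml; apply: ler_sum => i _.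
  by rewrite (snZ pS) mulrC ler_wpM2l ?(sn_ge0 pS)// norm_mx_entry.
have [N [C [_ _ fP]]] := fL 0%N.
pose e := 1 / (2 * (K + 1) * A N).
have K1 : 0 < K + 1 by rewrite ltr_wpDl.
have e0 : 0 < e by rewrite divr_gt0// !mulr_gt0.
have [d1 d10 {}fP] := fP _ e0.
pose rho := Num.min (d1 / A N) (d2 / A N') / 2.
have m0 : 0 < Num.min (d1 / A N) (d2 / A N') by rewrite lt_min !divr_gt0.
have rho0 : 0 < rho by rewrite divr_gt0.
have rhom : rho < Num.min (d1 / A N) (d2 / A N').
  by rewrite ltr_pdivrMr// ltr_pMr// ltr1n.
have inball w : `|w| <= rho -> p N (x + B w - x) < d1 /\ p N' (x + B w - x) < d2.
  move=> wr; rewrite addrC addKr.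
  have : `|w| < Num.min (d1 / A N) (d2 / A N') by rewrite (le_lt_trans wr).
  rewrite lt_min => /andP[w1 w2]; rewrite !(le_lt_trans (pB _ _))//.
    by rewrite mulrC -ltr_pdivlMr.
  by rewrite mulrC -ltr_pdivlMr.
have B0 : B 0 = 0 by rewrite /B big1// => i _; rewrite mxE scale0r.
(* for such [y], the first Newton step stays within [rho / 2] *)
exists 0%N, (rho / (2 * (K + 1))); split=> [|y yfx].
  by rewrite divr_gt0// mulr_gt0.
pose G w := w - c (f (x + B w) - y).
have [||w wr Gw] := @contraction_ball d G rho rho0.
- rewrite /G B0 addr0 sub0r normrN (le_trans (cb _))// distrC.
  rewrite (@le_trans _ _ ((K + 1) * (rho / (2 * (K + 1)))))//.
    by rewrite ler_pM// ?lerDl// ltW.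
  by rewrite invfM mulrCA [(K + 1) * _]mulrCA divff ?gt_eqF// mulr1.
- move=> w w' /inball[wN _] /inball[wN' _].
  have E : x + B w - (x + B w') = B (w - w') by rewrite opprD addrACA subrr add0r BB.
  have -> : G w - G w' =
      - c (f (x + B w) - f (x + B w') - L (x + B w - (x + B w'))).
    rewrite E LB /G [c (f _ - f _ - _)]linearB /= sK.
    rewrite (_ : f _ - f _ = f (x + B w) - y - (f (x + B w') - y)); last first.
      by rewrite opprB addrA subrK.
    rewrite [c (_ - _ - (_ - _))]linearB /= [RHS]opprB !opprB.
    by rewrite [LHS]addrACA [RHS]addrACA [- c _ + _]addrC.
  rewrite normrN (le_trans (cb _))//.
  rewrite (le_trans (ler_wpM2l K0 (fP _ _ wN wN')))// E.
  rewrite (le_trans (ler_wpM2l K0 (ler_wpM2l (ltW e0) (pB _ _))))//.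
  rewrite !mulrA ler_wpM2r// /e.
  rewrite [leLHS](_ : _ = 1 / 2 * (K / (K + 1))); last first.
    by field; rewrite !gt_eqF.
  by rewrite ler_piMr// ?divr_ge0// ler_pdivrMr// mul1r lerDl.
- have [_ w2] := inball _ wr; exists (x + B w); first exact: dP.
  apply/eqP; rewrite -subr_eq0 -[_ - _]cK.
  by move/eqP: Gw; rewrite /G subr_eq addrC -subr_eq subrr => /eqP <-; rewrite linear0.
Qed.

End Openness.

(** * The vector space of trajectories *)

Section Trajectory_space.
Context {R : realType} {q n m : nat}.
Local Notation traj := (traj R q n m).
Implicit Types z : traj.

Lemma traj_ext z z' : past z = past z' -> state z = state z' ->
  (forall a, inp z a = inp z' a) -> z = z'.
Proof.
by case: z z' => [Z x u] [Z' x' u'] /= -> -> /funext ->.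
Qed.

(** With the operations below, the derivative of a map between trajectories is a
    linear map of the same kind: the linearized system is again a system. *)
HB.instance Definition _ := gen_eqMixin traj.
HB.instance Definition _ := gen_choiceMixin traj.

Definition traj_add z z' : traj :=
  Traj (past z + past z') (state z + state z') (fun a => inp z a + inp z' a).
Definition traj_opp z : traj :=
  Traj (- past z) (- state z) (fun a => - inp z a).
Definition traj_zero : traj := Traj 0 0 (fun=> 0).
Definition traj_scale (a : R) z : traj :=
  Traj (a *: past z) (a *: state z) (fun k => a *: inp z k).

Fact traj_addA : associative traj_add.
Proof. by move=> x y z; apply: traj_ext => [||a] /=; rewrite addrA. Qed.
Fact traj_addC : commutative traj_add.
Proof. by move=> x y; apply: traj_ext => [||a] /=; rewrite addrC. Qed.
Fact traj_add0 : left_id traj_zero traj_add.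
Proof. by move=> x; apply: traj_ext => [||a] /=; rewrite add0r. Qed.
Fact traj_addN : left_inverse traj_zero traj_opp traj_add.
Proof. by move=> x; apply: traj_ext => [||a] /=; rewrite addNr. Qed.

HB.instance Definition _ :=
  GRing.isZmodule.Build traj traj_addA traj_addC traj_add0 traj_addN.

Fact traj_scaleA a b z : traj_scale a (traj_scale b z) = traj_scale (a * b) z.
Proof. by apply: traj_ext => [||k] /=; rewrite scalerA. Qed.
Fact traj_scale1 : left_id 1 traj_scale.
Proof. by move=> z; apply: traj_ext => [||k] /=; rewrite scale1r. Qed.
Fact traj_scaleDr : right_distributive traj_scale +%R.
Proof. by move=> a z z'; apply: traj_ext => [||k] /=; rewrite scalerDr. Qed.
Fact traj_scaleDl z : {morph traj_scale^~ z : a b / a + b}.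
Proof. by move=> a b; apply: traj_ext => [||k] /=; rewrite scalerDl. Qed.

HB.instance Definition _ := GRing.Zmodule_isLmodule.Build R traj
  traj_scaleA traj_scale1 traj_scaleDr traj_scaleDl.

Lemma window_linear N : linear (window N : traj -> _).
Proof.
move=> a z z'; rewrite /window /=; congr (_, _).
by apply/matrixP => k l; rewrite !mxE.
Qed.

Definition sn_traj (N : nat) z : R := `|window N z|.

Lemma sn_traj_le N z (c : R) : 0 <= c ->
  sn_traj N z <= c <-> [/\ `|past z| <= c, `|state z| <= c &
                           forall a, (a < N)%N -> `|inp z a| <= c].
Proof.
move=> c0; rewrite /sn_traj /window !prod_normE /= !ge_max -andbA.
split=> [/and3P[-> -> ic]|[-> -> ic] /=].
  split=> // a aN; apply: norm_mx_le => // i j; rewrite (ord1 i).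
  rewrite (le_trans _ ic)//.
  have := norm_mx_entry (\matrix_(a < N) inp z a) (Ordinal aN) j.
  by rewrite mxE.
apply: norm_mx_le => // a j; rewrite mxE.
by rewrite (le_trans (norm_mx_entry _ _ _))// ic.
Qed.

Lemma sn_traj_sn : seminorms sn_traj.
Proof.
split=> [M N z MN|N z z'|N a z].
- have /sn_traj_le[//|? ? ic] := lexx (sn_traj N z).
    exact: normr_ge0.
  apply/sn_traj_le; first exact: normr_ge0.
  by split=> // a aM; rewrite ic// (leq_trans aM).
- rewrite /sn_traj -[z in leLHS]scale1r window_linear scale1r.
  exact: ler_normD.
- by rewrite /sn_traj -normrZ -[a *: z]addr0 window_linear (_ : window N 0 = 0)
    ?addr0//; rewrite /window /=; congr (_, _); apply/matrixP => k l; rewrite !mxE.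
Qed.

Lemma sn_traj_ge N z : [/\ `|past z| <= sn_traj N z,
  `|state z| <= sn_traj N z & forall a, (a < N)%N -> `|inp z a| <= sn_traj N z].
Proof. by apply/sn_traj_le => //; exact: normr_ge0. Qed.

Lemma near_trajP z (P : traj -> Prop) :
  (\forall c \near traj_nbhs z, P c) <-> near_sn sn_traj z P.
Proof.
have wB N c : sn_traj N (c - z) = `|window N c - window N z|.
  rewrite /sn_traj addrC -scaleN1r window_linear scaleN1r.
  by rewrite addrC.
split=> [[N /near_ball_norm[d d0 dP]]|[N [d [d0 dP]]]].
  by exists N, d; split=> // c; rewrite wB => /dP; apply.
exists N; apply/near_ball_norm; exists d => // w wd c cw.
by apply: dP; rewrite wB cw.
Qed.

End Trajectory_space.

(** * Shifts of trajectories *)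

Section Shift.
Context {R : realType} {q n m : nat}.
Local Notation traj := (traj R q n m).
Context (f : 'rV[R]_(n + m) -> 'rV[R]_n) (g : 'rV[R]_(n + m) -> 'rV[R]_m).
Context (phi : 'M[R]_(q, m) * 'rV[R]_n * 'rV[R]_m -> 'rV[R]_m).
Local Notation shift := (step f g open_loop).
Local Notation y := (shifted_output f g phi).
Implicit Types z : traj.

Lemma inp_iter_step fb k z a : inp (iter k (step f g fb) z) a = inp z (k + a).
Proof. by elim: k a => [|k IH] a //=; rewrite IH addnS. Qed.

Lemma output_shift k l z : y k (iter l shift z) = y (k + l) z.
Proof. by rewrite /shifted_output /output iterD. Qed.

Lemma output_step k z : y k (shift z) = y k.+1 z.
Proof. by rewrite -[k.+1]addn1 -output_shift. Qed.

Context (blk : 'I_m -> nat) (tau : {perm 'I_m}) (K : nat -> 'I_m -> nat).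
Local Notation crd i := (coords f g phi blk tau K i).

Lemma coords_step i z a : inp (crd i (shift z)) a = inp (crd i z) a.+1.
Proof. by apply/rowP => j; rewrite !mxE output_step addnS. Qed.

Lemma coords_iter i k z a :
  inp (crd i (iter k shift z)) a = inp (crd i z) (k + a).
Proof. by elim: k a => [|k IH] a //; rewrite iterS coords_step IH addnS. Qed.

End Shift.

Section Linear_shift.
Context {R : realType} {q n m : nat}.
Local Notation traj := (traj R q n m).
Context (f : {linear 'rV[R]_(n + m) -> 'rV[R]_n}).
Context (g : {linear 'rV[R]_(n + m) -> 'rV[R]_m}).
Context (phi : {linear ('M[R]_(q, m) * 'rV[R]_n * 'rV[R]_m)%type -> 'rV[R]_m}).

Lemma push_linear a (Z Z' : 'M[R]_(q, m)) (v v' : 'rV[R]_m) :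
  push (a *: Z + Z') (a *: v + v') = a *: push Z v + push Z' v'.
Proof.
by rewrite /push -add_col_mx -scale_col_mx; apply/matrixP => b c; rewrite !mxE.
Qed.

Lemma step_linear : linear (step f g open_loop : traj -> traj).
Proof.
have E a (x x' : 'rV[R]_n) (u u' : 'rV[R]_m) :
    row_mx (a *: x + x') (a *: u + u') = a *: row_mx x u + row_mx x' u'.
  by rewrite -add_row_mx -scale_row_mx.
move=> a z z'; apply: traj_ext => [||k] //=.
  by rewrite /open_loop /= E linearP push_linear.
by rewrite /open_loop /= E linearP.
Qed.

Lemma output_linear k : linear (shifted_output f g phi k : traj -> 'rV[R]_m).
Proof.
elim: k => [|k IH] a z z'.
  by rewrite /shifted_output /output -linearP.
by rewrite -!output_step step_linear IH.
Qed.

Context (blk : 'I_m -> nat) (tau : {perm 'I_m}) (K : nat -> 'I_m -> nat).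

Lemma coords_linear i : linear (coords f g phi blk tau K i : traj -> traj).
Proof.
move=> a z z'; apply: traj_ext => [||k] //=.
by apply/rowP => j; rewrite !mxE output_linear !mxE; case: ifP.
Qed.

Lemma coordsD i (z z' : traj) : coords f g phi blk tau K i (z + z') =
  coords f g phi blk tau K i z + coords f g phi blk tau K i z'.
Proof. by have := coords_linear i 1 z z'; rewrite !scale1r. Qed.

Lemma coordsB i (z z' : traj) : coords f g phi blk tau K i (z - z') =
  coords f g phi blk tau K i z - coords f g phi blk tau K i z'.
Proof. by have := coords_linear i (-1) z' z; rewrite !scaleN1r ![- _ + _]addrC. Qed.

Lemma outputB k (z z' : traj) : shifted_output f g phi k (z - z') =
  shifted_output f g phi k z - shifted_output f g phi k z'.
Proof. by have := output_linear k (-1) z' z; rewrite !scaleN1r ![- _ + _]addrC. Qed.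

End Linear_shift.

(** * The linearized procedure *)

Section Linear_step.
Context {R : realType} {q n m : nat}.
Local Notation traj := (traj R q n m).
Context (f : {linear 'rV[R]_(n + m) -> 'rV[R]_n}).
Context (g : {linear 'rV[R]_(n + m) -> 'rV[R]_m}).
Context (phi : {linear ('M[R]_(q, m) * 'rV[R]_n * 'rV[R]_m)%type -> 'rV[R]_m}).
Context (blk : 'I_m -> nat) (tau : {perm 'I_m}) (K : nat -> 'I_m -> nat).
Local Notation shift := (step f g open_loop).
Local Notation y := (shifted_output f g phi).
Local Notation crd i := (coords f g phi blk tau K i).

(** The common kernel of the coordinates on which the outputs may depend before
    step [i + 1] selects a shift. *)
Definition low (i : nat) (c : traj) := [/\ past c = 0, state c = 0 &
  forall a l, (blk l <= i)%N -> inp c a ord0 l = 0].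

Definition onto i := forall c, exists z, crd i z = c.

(** Linear form of the fact that the replacement of inputs in the first [i] steps
    can be undone without using shifts of the remaining inputs. *)
Definition input_determined i := forall z, low i (crd i z) ->
  (forall l, (i < blk l)%N -> inp (crd i z) 0%N ord0 l = 0) -> inp z 0%N = 0.

Definition impulse (N : nat) (w : 'rV[R]_m) : traj :=
  Traj 0 0 (fun a => if a == N then w else 0).

Lemma coords0 : (forall j, (0 < blk j)%N) -> onto 0 /\ input_determined 0.
Proof.
move=> blk0; have E z a j : inp (crd 0 z) a ord0 j = inp z a ord0 (tau j).
  by rewrite mxE leqNgt blk0.
split=> [c|z _ z0].
  exists (Traj (past c) (state c) (fun a => \row_l inp c a ord0 ((tau^-1)%g l))).
  by apply: traj_ext => // a; apply/rowP => j; rewrite E mxE permK.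
apply/rowP => l; rewrite -[l](permKV tau) -E z0 ?mxE; [by []|exact: blk0].
Qed.

Section One_step.
Context (i : nat).
Context (dE : 'I_m -> nat -> {linear traj -> R}).
Hypothesis crd_onto : onto i.
Hypothesis crd_input : input_determined i.
Hypothesis dE_output : forall j k z, (i < blk j)%N -> (k <= K i.+1 j)%N ->
  y k z ord0 j = dE j k (crd i z).
Hypothesis dE_low : forall j k c, (i < blk j)%N -> (k < K i.+1 j)%N ->
  low i c -> dE j k c = 0.

Definition in_block (w : 'rV[R]_m) := forall l, blk l != i.+1 -> w ord0 l = 0.

Hypothesis dE_inj : forall w, in_block w ->
  (forall j, blk j = i.+1 -> dE j (K i.+1 j) (impulse 0 w) = 0) -> w = 0.
Hypothesis dE_surj : forall t : 'I_m -> R, exists2 w, in_block w &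
  forall j, blk j = i.+1 -> dE j (K i.+1 j) (impulse 0 w) = t j.

Lemma step_low z : low i (crd i z) -> inp z 0%N = 0 -> low i (crd i (shift z)).
Proof.
move=> [Z0 x0 v0] u0; have E : row_mx (state z) (open_loop z) = 0.
  by rewrite /open_loop [state z]x0 u0 row_mx0.
split=> [||a l li]; last by rewrite coords_step v0.
- rewrite /= E linear0 [past z]Z0; apply/matrixP => b c; rewrite !mxE.
  by case: splitP => k _; rewrite mxE.
- by rewrite /= E linear0.
Qed.

(** A step of the system with vanishing input keeps the past and the state zero,
    and the preceding shift of [y^j] does not see the remaining inputs. *)
Lemma output_low_rest z j : (i < blk j)%N -> low i (crd i z) ->
  (forall l, (i < blk l)%N -> inp (crd i z) 0%N ord0 l = 0) ->
  y (K i.+1 j) z ord0 j = 0.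
Proof.
move=> ij zl z0; have u0 := crd_input zl z0.
case EK: (K i.+1 j) => [|k].
  have [/= Z0 x0 _] := zl.
  rewrite /shifted_output /output /= /open_loop Z0 x0 u0.
  by rewrite (_ : (0, 0, 0) = 0)// linear0 mxE.
rewrite -output_step dE_output ?EK// dE_low ?EK//.
exact: step_low.
Qed.

(** The first shift of [y^j] that sees the remaining inputs sees only their
    unshifted values, because [u] enters through one step of the system. *)
Lemma output_low z j : (i < blk j)%N -> low i (crd i z) ->
  y (K i.+1 j) z ord0 j = dE j (K i.+1 j) (impulse 0 (inp (crd i z) 0%N)).
Proof.
move=> ij zl; rewrite dE_output//; apply/eqP; rewrite -subr_eq0 -linearB.
have [z' z'E] := crd_onto (crd i z - impulse 0 (inp (crd i z) 0%N)).
rewrite -z'E -dE_output//; apply/eqP; have [Z0 x0 v0] := zl.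
apply: output_low_rest => //; rewrite z'E.
  split=> [||a l li] /=; rewrite ?subr0//.
  have /= := v0 a l li; rewrite !mxE => ->; case: a => [|a]; rewrite ?mxE.
    by have /= := v0 0%N l li; rewrite !mxE => ->; rewrite subrr.
  by rewrite subr0.
by move=> l _ /=; rewrite !mxE subrr.
Qed.

Lemma low_iter_shift N z : low i (crd i z) ->
  (forall a l, (a < N)%N -> (i < blk l)%N -> inp (crd i z) a ord0 l = 0) ->
  low i (crd i (iter N shift z)).
Proof.
move=> zl; elim: N => [//|N IH] z0; rewrite iterS.
have NL : low i (crd i (iter N shift z)).
  by apply: IH => a l aN; apply: z0; rewrite ltnW.
apply: step_low => //; apply: crd_input => // l il.
by rewrite coords_iter addn0 z0.
Qed.

Lemma coords_same z a l : blk l != i.+1 ->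
  inp (crd i.+1 z) a ord0 l = inp (crd i z) a ord0 l.
Proof. by move=> li; rewrite !mxE leq_eqVlt (negbTE li) ltnS. Qed.

Lemma coords_new z a j : blk j = i.+1 ->
  inp (crd i.+1 z) a ord0 j = y (K i.+1 j + a) z ord0 j.
Proof. by move=> ji; rewrite !mxE /kappa ji leqnn. Qed.

(** The invertible block gives the inputs replaced in step [i + 1] back from the
    new [v], and the earlier steps give the others. *)
Lemma input_determined_step : input_determined i.+1.
Proof.
move=> z [Z0 x0 v0] r0; have zl : low i (crd i z).
  split=> // a l li; rewrite -coords_same ?v0 ?(leq_trans li)//.
  by rewrite neq_ltn ltnS li.
have w_block : in_block (inp (crd i z) 0%N).
  move=> l li; rewrite -coords_same//.
  by move: li; rewrite neq_ltn => /orP[/ltnW/v0|/r0].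
apply: crd_input => // l _; rewrite (dE_inj w_block) ?mxE// => j ji.
by rewrite -output_low ?ji// -[K i.+1 j]addn0 -coords_new// v0 ?ji.
Qed.

(** At time [N], the new [v] depends on the replaced inputs at times up to [N],
    and on those at time [N] through the invertible block. So these inputs can
    be chosen successively to give [v] prescribed values. *)
Lemma onto_step : onto i.+1.
Proof.
move=> c; have [pre preK] := choice crd_onto.
have [inv invP] := choice (fun t => let: ex_intro2 w a b := dE_surj t in
  ex_intro (fun w => in_block w /\ forall j, blk j = i.+1 ->
    dE j (K i.+1 j) (impulse 0 w) = t j) w (conj a b)).
(* the input at time [N] that corrects the new [v] of [z] at that time *)
pose w N z := inv (fun j => inp c N ord0 j - y (K i.+1 j + N) z ord0 j).
pose c0 := Traj (past c) (state c)
  (fun a => \row_l (if blk l == i.+1 then 0 else inp c a ord0 l)) : traj.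
pose fix approx N : traj := if N is N'.+1 then
  approx N' + pre (impulse N' (w N' (approx N'))) else pre c0.
pose wN N := w N (approx N).
have wB N : in_block (wN N) by have [] := invP (fun j =>
  inp c N ord0 j - y (K i.+1 j + N) (approx N) ord0 j).
have approxE N : crd i (approx N) = Traj (past c) (state c)
    (fun a => inp c0 a + (if (a < N)%N then wN a else 0)).
  elim: N => [|N IH] /=; first by rewrite preK; apply: traj_ext => // a /=; rewrite addr0.
  rewrite coordsD IH preK.
  apply: traj_ext => [||a] /=; rewrite ?addr0// ltnS -addrA; congr (_ + _).
  by case: (ltngtP a N) => [_|_|->]; rewrite ?addr0 ?add0r.
pose cw := Traj (past c) (state c) (fun a => inp c0 a + wN a) : traj.
exists (pre cw).
have preE a : inp (crd i (pre cw)) a = inp c0 a + wN a by rewrite preK.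
apply: traj_ext => [||N].
- by rewrite -[LHS]/(past (crd i (pre cw))) preK.
- by rewrite -[LHS]/(state (crd i (pre cw))) preK.
apply/rowP => l; have [li|li] := eqVneq (blk l) i.+1; last first.
  by rewrite coords_same// preE mxE wB// addr0 mxE (negbTE li).
(* [approx N] has the right inputs before time [N], so the difference is an
   input sequence that starts at time [N] *)
rewrite coords_new//; pose d := pre cw - approx N.
have dE' : crd i d = Traj 0 0 (fun a => if (a < N)%N then 0 else wN a).
  rewrite /d coordsB preK approxE.
  apply: traj_ext => [||a] /=; rewrite ?subrr//.
  rewrite opprD addrACA subrr add0r.
  by case: ifP; rewrite ?subrr ?subr0.
have dl : low i (crd i d).
  rewrite dE'; split=> // a k ki /=; case: ifP => _; rewrite ?mxE ?wB//.
  by rewrite neq_ltn ltnS ki.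
have Nl : low i (crd i (iter N shift d)).
  by apply: low_iter_shift => // a k aN _; rewrite dE' /= aN mxE.
have := output_low (j := l) _ Nl; rewrite li ltnSn output_shift => /(_ isT).
rewrite coords_iter addn0 dE' /= ltnn.
have [_ ->//] := invP (fun j => inp c N ord0 j - y (K i.+1 j + N) (approx N) ord0 j).
rewrite /d outputB !mxE; exact: addIr.
Qed.

End One_step.

End Linear_step.

(** * Differentiability of the shifts at the equilibrium *)

Section Differentiability.
Context {R : realType} {q n m : nat}.
Local Notation traj := (traj R q n m).
Local Notation sn := (sn_traj (R := R) (q := q) (n := n) (m := m)).
Let snP := @sn_traj_sn R q n m.

Lemma past_entry_linear b c : linear (fun z : traj => past z b c).
Proof. by move=> a z z'; rewrite !mxE. Qed.
Lemma state_entry_linear j : linear (fun z : traj => state z ord0 j).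
Proof. by move=> a z z'; rewrite !mxE. Qed.
Lemma inp_entry_linear a j : linear (fun z : traj => inp z a ord0 j).
Proof. by move=> k z z'; rewrite !mxE. Qed.

Lemma rdiff_past x b c : rdiff sn x (fun z => past z b c) (fun z => past z b c).
Proof.
apply: (@rdiff_linear _ _ _ _ _ 0%N (past_entry_linear b c) snP) => h.
by have [+ _ _] := sn_traj_ge 0 h; apply: le_trans; exact: norm_mx_entry.
Qed.

Lemma rdiff_state x j : rdiff sn x (fun z => state z ord0 j) (fun z => state z ord0 j).
Proof.
apply: (@rdiff_linear _ _ _ _ _ 0%N (state_entry_linear j) snP) => h.
by have [_ + _] := sn_traj_ge 0 h; apply: le_trans; exact: norm_mx_entry.
Qed.

Lemma rdiff_inp x a j : rdiff sn x (fun z => inp z a ord0 j) (fun z => inp z a ord0 j).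
Proof.
apply: (@rdiff_linear _ _ _ _ _ a.+1 (inp_entry_linear a j) snP) => h.
have [_ _ /(_ a (ltnSn a))] := sn_traj_ge a.+1 h.
by apply: le_trans; exact: norm_mx_entry.
Qed.

Lemma sdiff_traj (X : lmodType R) (p : nat -> X -> R) x (F : X -> traj)
    (L : {linear X -> traj}) : seminorms p ->
  (forall b c, rdiff p x (fun z => past (F z) b c) (fun z => past (L z) b c)) ->
  (forall j, rdiff p x (fun z => state (F z) ord0 j) (fun z => state (L z) ord0 j)) ->
  (forall a j, rdiff p x (fun z => inp (F z) a ord0 j) (fun z => inp (L z) a ord0 j)) ->
  sdiff p sn x F L.
Proof.
move=> pS Fp Fs Fi; apply: sdiff_coords => // M.
exists (('I_q * 'I_m) + 'I_n + ('I_M * 'I_m))%type.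
exists (fun (i : ('I_q * 'I_m + 'I_n + 'I_M * 'I_m)%type) (z : traj) => match i with
  | inl (inl bc) => past z bc.1 bc.2 | inl (inr j) => state z ord0 j
  | inr aj => inp z aj.1 ord0 aj.2 end).
split=> [[[[b c]|j]|[a j]] z z' /=|c z c0 zc|[[[b c]|j]|[a j]]].
- by rewrite !mxE.
- by rewrite !mxE.
- by rewrite !mxE.
- apply/sn_traj_le => //; split=> [||a aM]; apply: norm_mx_le => // i j.
  + exact: (zc (inl (inl (i, j)))).
  + by rewrite (ord1 i); exact: (zc (inl (inr j))).
  + by rewrite (ord1 i); exact: (zc (inr (Ordinal aM, j))).
- exact: Fp.
- exact: Fs.
- exact: Fi.
Qed.

Context (f : 'rV[R]_(n + m) -> 'rV[R]_n) (g : 'rV[R]_(n + m) -> 'rV[R]_m).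
Context (phi : 'M[R]_(q, m) * 'rV[R]_n * 'rV[R]_m -> 'rV[R]_m).
Context (x0 : 'rV[R]_n) (u0 : 'rV[R]_m).
Let w0 := row_mx x0 u0.
Local Notation eqt := (eq_traj (q := q) g x0 u0).
Context (df : {linear 'rV[R]_(n + m) -> 'rV[R]_n}).
Context (dg : {linear 'rV[R]_(n + m) -> 'rV[R]_m}).
Context (dphi : {linear ('M[R]_(q, m) * 'rV[R]_n * 'rV[R]_m)%type -> 'rV[R]_m}).
Hypothesis f_eq : f w0 = x0.
Hypothesis f_diff : sdiff (nrm (V := _)) (nrm (V := _)) w0 f df.
Hypothesis g_diff : sdiff (nrm (V := _)) (nrm (V := _)) w0 g dg.
Hypothesis phi_diff :
  sdiff (nrm (V := _)) (nrm (V := _)) (eq_past g x0 u0, x0, u0) phi dphi.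

Lemma step_eq : step f g open_loop eqt = eqt.
Proof.
apply: traj_ext => //=; rewrite /open_loop /= -/w0 ?f_eq//.
apply/matrixP => b c; rewrite !mxE; case: splitP => k _; last by rewrite mxE.
by rewrite (ord1 k).
Qed.

Lemma iter_step_eq k : iter k (step f g open_loop) eqt = eqt.
Proof. by elim: k => //= k ->; rewrite step_eq. Qed.

Lemma output_eq k : shifted_output f g phi k eqt = eq_output g phi x0 u0.
Proof. by rewrite /shifted_output /output iter_step_eq. Qed.

Lemma state_input_linear : linear (fun z : traj => row_mx (state z) (inp z 0%N)).
Proof. by move=> a z z'; rewrite /= -add_row_mx -scale_row_mx. Qed.

Lemma state_input_diff : sdiff sn (nrm (V := _)) eqt
  (fun z => row_mx (state z) (inp z 0%N)) (linear_pack state_input_linear).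
Proof.
apply: sdiff_linear; [exact: snP|exact: nrm_sn|move=> M].
exists 1%N, 1; split=> // h; rewrite mul1r /nrm /=.
have [_ sh ih] := sn_traj_ge 1 h.
apply: norm_mx_le => [|i j]; first exact: normr_ge0.
rewrite mxE; case: splitP => k _; rewrite (le_trans (norm_mx_entry _ _ _))//.
exact: ih.
Qed.

Definition dstep : {linear traj -> traj} := linear_pack (step_linear df dg).

Lemma step_diff : sdiff sn sn eqt (step f g open_loop) dstep.
Proof.
have fwd := sdiff_comp snP (nrm_sn _) (nrm_sn _) state_input_diff f_diff.
have gwd := sdiff_comp snP (nrm_sn _) (nrm_sn _) state_input_diff g_diff.
apply: sdiff_traj => [|b c|j|a j]; first exact: snP.
- case bE: (val b) => [|b'].
    have E (Z : 'M[R]_(q, m)) v : push Z v b c = v ord0 c.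
      rewrite mxE -[RHS](col_mxEu v Z); congr (col_mx v Z _ c).
      by apply: val_inj; rewrite /= bE.
    by apply: rdiff_ext (rdiff_entry ord0 c snP gwd) => z /=; rewrite E.
  have b'q : (b' < q)%N by apply: ltnW; rewrite -bE ltn_ord.
  have E (Z : 'M[R]_(q, m)) v : push Z v b c = Z (Ordinal b'q) c.
    rewrite mxE -[RHS](col_mxEd v Z); congr (col_mx v Z _ c).
    by apply: val_inj; rewrite /= bE.
  by apply: rdiff_ext (rdiff_past eqt (Ordinal b'q) c) => z /=; rewrite E.
- exact: (rdiff_entry _ _ snP fwd).
- exact: rdiff_inp.
Qed.

Lemma point_linear : linear (fun z : traj => (past z, state z, inp z 0%N)).
Proof. by []. Qed.

Lemma point_diff : sdiff sn (nrm (V := _)) eqt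
  (fun z => (past z, state z, inp z 0%N)) (linear_pack point_linear).
Proof.
apply: sdiff_linear; [exact: snP|exact: nrm_sn|move=> M].
exists 1%N, 1; split=> // h; rewrite mul1r /nrm /= !prod_normE /= !ge_max.
by have [-> -> ->] := sn_traj_ge 1 h.
Qed.

Definition doutput k : {linear traj -> 'rV[R]_m} :=
  linear_pack (output_linear df dg dphi k).

Lemma output_diff k :
  sdiff sn (nrm (V := _)) eqt (shifted_output f g phi k) (doutput k).
Proof.
elim: k => [|k IH].
  exact: (sdiff_comp snP (nrm_sn _) (nrm_sn _) point_diff phi_diff).
have IH' : sdiff sn (nrm (V := _)) (step f g open_loop eqt)
    (shifted_output f g phi k) (doutput k) by rewrite step_eq.
have := sdiff_comp snP snP (nrm_sn _) step_diff IH'.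
rewrite (_ : _ \o _ = shifted_output f g phi k.+1); last first.
  by apply/funext => z /=; rewrite output_step.
by apply: sdiff_extL => z /=; rewrite output_step.
Qed.

Context (blk : 'I_m -> nat) (tau : {perm 'I_m}) (K : nat -> 'I_m -> nat).

Definition dcoords i : {linear traj -> traj} :=
  linear_pack (coords_linear df dg dphi blk tau K i).

Lemma coords_diff i :
  sdiff sn sn eqt (coords f g phi blk tau K i) (dcoords i).
Proof.
apply: sdiff_traj => [|b c|j|a j]; first exact: snP.
- exact: rdiff_past.
- exact: rdiff_state.
case blkj: (blk j <= i)%N.
  apply: rdiff_ext (rdiff_entry ord0 j snP (output_diff (kappa blk K j + a))).
    by move=> z /=; rewrite mxE blkj.
  by move=> z /=; rewrite mxE blkj.
apply: rdiff_ext (rdiff_inp eqt a (tau j)) => z /=; rewrite mxE blkj//.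
Qed.

(** A smooth function of a window is strictly differentiable, and windows are
    bounded linear maps. *)
Lemma traj_smooth_diff (z : traj) h : traj_smooth z h ->
  exists L : {linear traj -> R}, sdiff sn (nrm (V := R)) z h L.
Proof.
move=> [N [H [Hs /near_trajP hH]]].
have Vf : findim ('M[R]_(q, m) * 'rV[R]_n * 'M[R]_(N, m))%type.
  by do 2?[apply: findim_prod]; exact: findim_mx.
have HL := smooth_sdiff Vf Hs.
have WL : sdiff sn (nrm (V := _)) z (window N) (linear_pack (window_linear N)).
  apply: sdiff_linear; [exact: snP|exact: nrm_sn|move=> M].
  by exists N, 1; split=> // v; rewrite mul1r.
exists ('d H (window N z) \o linear_pack (window_linear N)).
have := sdiff_comp snP (nrm_sn _) (nrm_sn _) WL HL.
by apply: sdiff_eq => //; apply: near_snW hH => a ->.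
Qed.

End Differentiability.

(** * From the procedure to its linearization *)

Section Block_solve.
Context {F : fieldType} {m : nat}.

Lemma sum_block (B : {set 'I_m}) (w : 'rV[F]_m) (J : 'M[F]_m) l :
  (forall k, k \notin B -> w ord0 k = 0) ->
  (w *m J) ord0 l = \sum_(a < #|B|) w ord0 (enum_val a) * J (enum_val a) l.
Proof.
move=> w0; rewrite mxE (bigID (mem B)) /= [X in _ + X]big1 ?addr0.
  by rewrite big_enum_val.
by move=> k kB; rewrite w0// mul0r.
Qed.

Context (B : {set 'I_m}) (J : 'M[F]_m).
Local Notation M := (mxsub (fun a : 'I_#|B| => enum_val a)
  (fun b : 'I_#|B| => enum_val b) J : 'M[F]_(#|B|, #|B|)).
Hypothesis M_unit : \rank M = #|B|.

Lemma block_inj (w : 'rV[F]_m) : (forall k, k \notin B -> w ord0 k = 0) ->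
  (forall j, j \in B -> (w *m J) ord0 j = 0) -> w = 0.
Proof.
move=> w0 wJ; pose v := \row_(a < #|B|) w ord0 (enum_val a).
have vM : v *m M = 0.
  apply/rowP => b; rewrite [RHS]mxE -[RHS](wJ _ (enum_valP b)) (sum_block _ _ w0).
  by rewrite mxE; apply: eq_bigr => a _; rewrite !mxE.
have Mfree : row_free M by rewrite /row_free M_unit.
have v0 : v = 0 by apply: (row_free_inj Mfree); rewrite vM mul0mx.
apply/rowP => k; rewrite mxE; have [kB|/w0//] := boolP (k \in B).
have /rowP/(_ (enum_rank_in kB k)) := v0.
by rewrite !mxE enum_rankK_in.
Qed.

Lemma block_surj (t : 'I_m -> F) :
  exists2 w : 'rV[F]_m, (forall k, k \notin B -> w ord0 k = 0) &
    forall j, j \in B -> (w *m J) ord0 j = t j.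
Proof.
have Mu : M \in unitmx by rewrite -row_full_unit /row_full M_unit.
pose v := (\row_b t (enum_val b)) *m invmx M.
pose w : 'rV[F]_m := \row_l \sum_(a < #|B|) v ord0 a *+ (enum_val a == l).
have w0 k : k \notin B -> w ord0 k = 0.
  move=> kB; rewrite mxE big1// => a _.
  by case: eqP => // ak; rewrite -ak enum_valP in kB.
have wv a : w ord0 (enum_val a) = v ord0 a.
  rewrite mxE (bigD1 a)//= eqxx big1 ?addr0// => b ba.
  by rewrite (inj_eq enum_val_inj) (negbTE ba).
exists w => // j jB; rewrite (sum_block _ _ w0).
have -> : t j = (v *m M) ord0 (enum_rank_in jB j).
  by rewrite /v mulmxKV// mxE enum_rankK_in.
rewrite mxE; apply: eq_bigr => a _.
by rewrite wv !mxE enum_rankK_in.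
Qed.

End Block_solve.

Section Line_derivatives.
Context {R : realType}.

Lemma line_deriv_cst (X : lmodType R) (V : normedModType R) (p : nat -> X -> R)
    x (f : X -> V) h (A : X -> Prop) : seminorms p -> near_sn p x A ->
  (forall t, A (x + t *: h) -> f (x + t *: h) = f x) -> line_deriv f x h 0.
Proof.
move=> pS [N [d [d0 dP]]] fA e e0.
have P0 : 0 < p N h + 1 by rewrite ltr_wpDl// (sn_ge0 pS).
exists (d / (p N h + 1)); first exact: divr_gt0.
move=> t /andP[t0 td]; rewrite fA ?subrr ?scaler0 ?subrr ?normr0 ?mulr_ge0 ?(ltW e0) ?(ltW t0)//.
apply: dP; rewrite [x + _]addrC addrK (snZ pS) gtr0_norm//.
have tp : t * p N h <= t * (p N h + 1) by rewrite ler_wpM2l ?lerDl// ltW.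
by rewrite (le_lt_trans tp)// -ltr_pdivlMr.
Qed.

Lemma diff_line_deriv (V W : normedModType R) (f : V -> W) x h :
  differentiable f x -> line_deriv f x h ('d f x h).
Proof.
move=> /diff_locallyP[_ /eqaddoP fd] e e0.
have P0 : 0 < `|h| + 1 by rewrite ltr_wpDl.
have := fd _ (divr_gt0 e0 P0) => /near_ball_norm[d d0 dP].
exists (d / (`|h| + 1)); first exact: divr_gt0.
move=> t /andP[t0 td].
have tp : t * `|h| <= t * (`|h| + 1) by rewrite ler_wpM2l ?lerDl// ltW.
have /dP : `|t *: h - 0| < d.
  rewrite subr0 normrZ gtr0_norm//.
  by rewrite (le_lt_trans tp)// -ltr_pdivlMr.
rewrite -[(_ - (_ + _)) _]/(f (t *: h + x) - (f x + 'd f x (t *: h))) linearZ /=.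
rewrite normrZ gtr0_norm// [t *: h + x]addrC opprD addrA => fd'.
rewrite (le_trans fd')//.
by rewrite mulrAC ler_pdivrMr// -mulrA ler_wpM2l// ltW.
Qed.

(** The term ['d f x] is chosen among the differentials of [f] at [x], and the
    choice defaults to the zero map. *)
Lemma diff_default (V W : normedModType R) (f : V -> W) x h :
  ~ differentiable f x -> 'd f x h = 0.
Proof.
move=> fN; rewrite /diff xgetPN// => L LP; apply: fN; apply/diffP.
by rewrite /diff; case: xgetP => [L1 _ //|/(_ L) []].
Qed.

End Line_derivatives.

Section Linearized_procedure.
Context {R : realType} {q n m : nat}.
Local Notation traj := (traj R q n m).
Local Notation sn := (sn_traj (R := R) (q := q) (n := n) (m := m)).
Let snP := @sn_traj_sn R q n m.
Context (f : 'rV[R]_(n + m) -> 'rV[R]_n) (g : 'rV[R]_(n + m) -> 'rV[R]_m).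
Context (phi : 'M[R]_(q, m) * 'rV[R]_n * 'rV[R]_m -> 'rV[R]_m).
Context (x0 : 'rV[R]_n) (u0 : 'rV[R]_m).
Local Notation eqt := (eq_traj (q := q) g x0 u0).
Context (df : {linear 'rV[R]_(n + m) -> 'rV[R]_n}).
Context (dg : {linear 'rV[R]_(n + m) -> 'rV[R]_m}).
Context (dphi : {linear ('M[R]_(q, m) * 'rV[R]_n * 'rV[R]_m)%type -> 'rV[R]_m}).
Hypothesis f_eq : f (row_mx x0 u0) = x0.
Hypothesis f_diff : sdiff (nrm (V := _)) (nrm (V := _)) (row_mx x0 u0) f df.
Hypothesis g_diff : sdiff (nrm (V := _)) (nrm (V := _)) (row_mx x0 u0) g dg.
Hypothesis phi_diff :
  sdiff (nrm (V := _)) (nrm (V := _)) (eq_past g x0 u0, x0, u0) phi dphi.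
Context (blk : 'I_m -> nat) (tau : {perm 'I_m}) (K : nat -> 'I_m -> nat).
Local Notation crd i := (coords f g phi blk tau K i).
Local Notation dcrd i := (dcoords df dg dphi blk tau K i).
Local Notation dy k := (doutput df dg dphi k).

(** Chain rule for [y^j_[k] = E o coords], with uniqueness of the derivative. *)
Lemma expressed_linear i j k (E : traj -> R) :
  expressed_by f g phi x0 u0 blk tau K i
    (fun z => shifted_output f g phi k z ord0 j) E ->
  exists2 L : {linear traj -> R}, sdiff sn (nrm (V := R)) (crd i eqt) E L &
    forall z, dy k z ord0 j = L (dcrd i z).
Proof.
move=> [/traj_smooth_diff[L EL] /near_trajP yE]; exists L => // z.
have cd := coords_diff f_eq f_diff g_diff phi_diff blk tau K i.
have [l ll yl] := rdiff_entry ord0 j snP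
  (output_diff f_eq f_diff g_diff phi_diff k).
have ed := sdiff_comp snP snP (nrm_sn _) cd EL.
by rewrite -ll; exact: (sdiff_unique snP yE yl ed z).
Qed.

(** [E] is constant along the line through [c0] in the direction [c]. *)
Lemma indep_low i (c0 : traj) (E : traj -> R) (L : {linear traj -> R}) c :
  sdiff sn (nrm (V := R)) c0 E L ->
  indep_of (fun=> mem (rest blk i)) c0 E -> low blk i c -> L c = 0.
Proof.
move=> EL [[A B] /= [/near_trajP nA /near_trajP nB] AB] [Z0 s0 v0].
apply: (line_deriv_unique (sdiff_line c snP EL)).
apply: (line_deriv_cst snP nA) => t At.
apply: (AB (c0 + t *: c, c0)); first by split=> //=; exact: near_sn_at snP nB.
- by rewrite /= Z0 scaler0 addr0.
- by rewrite /= s0 scaler0 addr0.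
move=> a j; rewrite /= inE -leqNgt => ji.
by rewrite !mxE v0// mulr0 addr0.
Qed.

(** Only the [E j] with [j] in the block are known to be differentiable; a nonzero
    rank makes the whole vector of the [E j] differentiable, and its Jacobian
    matrix then contains their derivatives. *)
Lemma jacobian_block (B : {set 'I_m}) (E : 'I_m -> traj -> R) (c0 : traj)
    (L : 'I_m -> {linear traj -> R}) :
  (forall j, j \in B -> sdiff sn (nrm (V := R)) c0 (E j) (L j)) ->
  \rank (input_jacobian B E c0) = #|B| ->
  (forall w : 'rV[R]_m, (forall k, k \notin B -> w ord0 k = 0) ->
    (forall j, j \in B -> L j (impulse 0 w) = 0) -> w = 0) /\
  (forall t : 'I_m -> R, exists2 w : 'rV[R]_m,
    (forall k, k \notin B -> w ord0 k = 0) &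
    forall j, j \in B -> L j (impulse 0 w) = t j).
Proof.
move=> EL; rewrite /input_jacobian => rkB; set J := 'J _ _ in rkB.
have [B0|[b bB]] := set_0Vmem B.
  split=> [w w0 _|t]; first by apply/rowP => k; rewrite mxE w0// B0 inE.
  by exists 0 => [k _|j]; rewrite ?mxE// B0 inE.
pose G w : 'rV[R]_m := \row_j E j (set_input0 c0 w).
(* a non-differentiable [G] has the zero Jacobian matrix by convention *)
have Gd : differentiable G (inp c0 0%N).
  apply: contrapT => /diff_default dG0.
  have : (0 < #|B|)%N by apply/card_gt0P; exists b.
  rewrite -rkB lt0n => /eqP; apply; apply/eqP; rewrite mxrank_eq0.
  by apply/eqP/matrixP => k l; rewrite !mxE /= dG0 mxE.
have LJ w j : j \in B -> L j (impulse 0 w) = (w *m J) ord0 j.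
  move=> jB; rewrite /J /jacobian mul_rV_lin1.
  have l1 := sdiff_line (impulse 0 w) snP (EL j jB).
  apply: (line_deriv_unique l1) => e e0.
  have [d d0 dP] := diff_line_deriv w Gd e0; exists d => // t td.
  apply: le_trans (dP t td).
  have := norm_mx_entry (G (inp c0 0%N + t *: w) - G (inp c0 0%N) -
    t *: 'd G (inp c0 0%N) w) ord0 j.
  rewrite !mxE; apply: le_trans.
  have -> : set_input0 c0 (inp c0 0%N + t *: w) = c0 + t *: impulse 0 w.
    apply: traj_ext => [||[|a]] /=; rewrite ?scaler0 ?addr0//.
  have -> // : set_input0 c0 (inp c0 0%N) = c0 by apply: traj_ext => // -[|a].
split=> [w w0 wL|t].
  by apply: (block_inj rkB w0) => j jB; rewrite -LJ// wL.
by have [w w0 wt] := block_surj rkB t; exists w => // j jB; rewrite LJ// wt.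
Qed.

Lemma procedure_step_linear i :
  procedure_step f g phi x0 u0 blk tau K i.+1 ->
  onto df dg dphi blk tau K i -> input_determined df dg dphi blk tau K i ->
  onto df dg dphi blk tau K i.+1 /\ input_determined df dg dphi blk tau K i.+1.
Proof.
move=> [E [/= Ey Eind _ _ /near_trajP/(near_sn_at snP) Erk]] io ii.
have L0 : linear ((fun=> 0) : traj -> R).
  by move=> a u v; rewrite scaler0 addr0.
have /choice[L LP] : forall jk : 'I_m * nat, exists L : {linear traj -> R},
    (i < blk jk.1)%N -> (jk.2 <= K i.+1 jk.1)%N ->
    sdiff sn (nrm (V := R)) (crd i eqt) (E jk.1 jk.2) L /\
    forall z, dy jk.2 z ord0 jk.1 = L (dcrd i z).
  move=> [j k] /=; have [ij|] := boolP (i < blk j)%N; last first.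
    by exists (linear_pack L0).
  have [kK|] := boolP (k <= K i.+1 j)%N; last by exists (linear_pack L0).
  have [|L LE Ly] := expressed_linear (Ey j k _ kK); first by rewrite inE.
  by exists L.
have blki j : j \in block blk i.+1 -> (i < blk j)%N by rewrite inE => /eqP ->.
have [|inj surj] := jacobian_block (L := fun j => L (j, K i.+1 j)) _ Erk.
  by move=> j /blki ij; have [] := LP (j, K i.+1 j) ij (leqnn _).
have dEy j k z : (i < blk j)%N -> (k <= K i.+1 j)%N ->
    shifted_output df dg dphi k z ord0 j = L (j, k) (dcrd i z).
  by move=> ij kK; have [_ ->] := LP (j, k) ij kK.
have dElow j k c : (i < blk j)%N -> (k < K i.+1 j)%N -> low blk i c -> L (j, k) c = 0.
  move=> ij kK; have [EL _] := LP (j, k) ij (ltnW kK).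
  by apply: (indep_low EL); apply: Eind; rewrite // inE.
have dEinj w : in_block blk i w ->
    (forall j, blk j = i.+1 -> L (j, K i.+1 j) (impulse 0 w) = 0) -> w = 0.
  move=> wB wL; apply: inj => [k|j]; first by rewrite inE; exact: wB.
  by rewrite inE => /eqP; exact: wL.
have dEsurj (t : 'I_m -> R) : exists2 w, in_block blk i w &
    forall j, blk j = i.+1 -> L (j, K i.+1 j) (impulse 0 w) = t j.
  have [w w0 wt] := surj t; exists w => [k ki|j ji]; first by apply: w0; rewrite inE.
  by apply: wt; rewrite inE ji.
split.
  exact: (@onto_step _ _ _ _ df dg dphi blk tau K i (fun j k => L (j, k))).
exact: (@input_determined_step _ _ _ _ df dg dphi blk tau K i (fun j k => L (j, k))).
Qed.

(** The last step exhausts the outputs, because its block has as many elements as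
    the rest in which it is contained. *)
Lemma procedure_linear s : procedure f g phi x0 u0 s blk tau K ->
  onto df dg dphi blk tau K s /\ forall j, (blk j <= s)%N.
Proof.
move=> [s0 blk0 Pi _ Ps].
have main i : (i <= s)%N ->
    onto df dg dphi blk tau K i /\ input_determined df dg dphi blk tau K i.
  elim: i => [_|i IH il]; first exact: coords0.
  have [io ii] := IH (ltnW il); apply: procedure_step_linear => //.
  by apply: Pi.
split=> [|j]; first by have [] := main s (leqnn s).
rewrite leqNgt; apply/negP => sj.
have : block blk s = rest blk s.-1.
  apply/eqP; rewrite eqEcard Ps leqnn andbT.
  by apply/fintype.subsetP => k; rewrite !inE => /eqP ->; rewrite prednK.
move=> /setP/(_ j); rewrite !inE prednK// (ltnW sj).
by rewrite gtn_eqF.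
Qed.

End Linearized_procedure.

(** * Jets of input sequences *)

Section Jets.
Context {R : realType} {m : nat}.
Implicit Types (A : 'I_m -> nat) (w : nat -> 'rV[R]_m).

Lemma eq_jet A w w' : (forall j a, (a < A j)%N -> w a ord0 j = w' a ord0 j) ->
  jet A w = jet A w'.
Proof. by move=> ww; apply/rowP => i; rewrite !mxE ww. Qed.

Lemma unjet_jet A w a j : (a < A j)%N -> unjet (jet A w) a ord0 j = w a ord0 j.
Proof. by move=> aA; rewrite mxE insubT mxE enum_rankK. Qed.

Lemma jet_unjet A (V : jetspace (R := R) A) : jet A (unjet V) = V.
Proof.
apply/rowP => i; rewrite !mxE; case: insubP => [b _ bE|]; last first.
  by rewrite ltn_ord.
rewrite -[i in RHS]enum_valK; congr (V _ (enum_rank _)).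
by case: (enum_val i) b bE => j a /= b /val_inj ->.
Qed.

Lemma unjet_entry_le A (V : jetspace (R := R) A) a j : `|unjet V a ord0 j| <= `|V|.
Proof.
rewrite mxE; case: insubP => [b _ _|_]; first exact: norm_mx_entry.
by rewrite normr0.
Qed.

Lemma unjetB A (V V' : jetspace (R := R) A) a : unjet (V - V') a = unjet V a - unjet V' a.
Proof.
by apply/rowP => j; rewrite !mxE; case: insubP => [b _ _|_]; rewrite ?mxE ?subrr.
Qed.

Lemma jet_linear A c w w' : jet A (fun a => c *: w a + w' a) = c *: jet A w + jet A w'.
Proof. by apply/rowP => i; rewrite !mxE. Qed.

Lemma jet0 A : jet A (fun=> 0 : 'rV[R]_m) = 0.
Proof. by apply/rowP => i; rewrite !mxE. Qed.

Lemma card_pairs A : #|{: pairs A}| = (\sum_j A j)%N.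
Proof.
rewrite card_tagged sumnE big_map big_enum /=.
by apply: eq_bigr => j _; rewrite card_ord.
Qed.

End Jets.

(** * The closed loop *)

Section Closed_loop.
Context {R : realType} {q n m : nat}.
Local Notation traj := (traj R q n m).
Local Notation sn := (sn_traj (R := R) (q := q) (n := n) (m := m)).
Let snP := @sn_traj_sn R q n m.
Context (f : 'rV[R]_(n + m) -> 'rV[R]_n) (g : 'rV[R]_(n + m) -> 'rV[R]_m).
Context (phi : 'M[R]_(q, m) * 'rV[R]_n * 'rV[R]_m -> 'rV[R]_m).
Context (r : 'I_m -> nat) (Fu : jetspace (R := R) (fun j => (r j).+1) -> 'rV[R]_m).
Context (s : nat) (blk : 'I_m -> nat) (tau : {perm 'I_m}) (K : nat -> 'I_m -> nat).
Context (vphi : forall j, nat ->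
  'M[R]_(q, m) * 'rV[R]_n * jetspace (R := R) (lower_v_order blk K r j) -> R).
Hypothesis blk_le : forall j, (blk j <= s)%N.
Local Notation kap := (kappa blk K).
Local Notation vo := (v_order blk K r).
Local Notation crd := (coords f g phi blk tau K s).
Local Notation shift := (step f g open_loop).
Local Notation y := (shifted_output f g phi).
Local Notation fb := (linearizing_feedback Fu vphi).
Implicit Types z : traj.

Definition lower_shifts_at z := forall j a, (a < kap j)%N -> y a z ord0 j =
  @vphi j a (past z, state z, jet (lower_v_order blk K r j) (inp (crd z))).

Lemma coords_outputE z a j : inp (crd z) a ord0 j = y (kap j + a) z ord0 j.
Proof. by rewrite mxE blk_le. Qed.

Lemma phi_map_coords z : lower_shifts_at z ->
  phi_map vphi (past z, state z, jet vo (inp (crd z))) =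
  jet (fun j => (r j).+1) (y ^~ z).
Proof.
move=> zl; apply: eq_jet => j a ar; rewrite mxE; case: ltnP => [ak|ka].
  rewrite zl//; congr (vphi _ (_, _, _)); apply: eq_jet => l b bl.
  rewrite unjet_jet//; move: bl; rewrite /lower_v_order /v_order.
  by case: ifP => // _ /leq_trans; apply; rewrite leq_sub2r.
rewrite unjet_jet; first by rewrite coords_outputE subnKC.
by rewrite /v_order ltn_sub2r// (leq_ltn_trans ka).
Qed.

Definition param_at z := inp z 0%N = Fu (jet (fun j => (r j).+1) (y ^~ z)).

Lemma feedback_coords z c : lower_shifts_at z -> param_at z ->
  past c = past z -> state c = state z ->
  (forall a j, (a < vo j)%N -> inp c a ord0 j = inp (crd z) a ord0 j) ->
  fb c = inp z 0%N.
Proof.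
move=> zl zp cZ cx cv; rewrite zp -phi_map_coords//.
by rewrite /linearizing_feedback cZ cx; congr (Fu (phi_map _ (_, _, _)));
  apply: eq_jet => j a; exact: cv.
Qed.

(** As long as the open-loop trajectory [z] stays in the domain of the flat
    parametrization, the closed loop started at its coordinates follows it. *)
Lemma closed_loop_follows z c N T : (forall j, (T + vo j <= N)%N) ->
  past c = past z -> state c = state z ->
  (forall a, (a < N)%N -> inp c a = inp (crd z) a) ->
  (forall k, (k <= T)%N ->
     lower_shifts_at (iter k shift z) /\ param_at (iter k shift z)) ->
  forall k, (k <= T)%N -> output f g phi fb k c = y k z.
Proof.
move=> TN cZ cx cv zG.
have fbk k : (k <= T)%N ->
    past (iter k (step f g fb) c) = past (iter k shift z) ->
    state (iter k (step f g fb) c) = state (iter k shift z) ->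
    fb (iter k (step f g fb) c) = inp (iter k shift z) 0%N.
  move=> kT ZE xE; have [zl zp] := zG k kT; apply: feedback_coords => // a j av.
  rewrite inp_iter_step coords_iter cv// (leq_trans _ (TN j))//.
  by rewrite -addnS leq_add.
have main k : (k <= T)%N ->
    past (iter k (step f g fb) c) = past (iter k shift z) /\
    state (iter k (step f g fb) c) = state (iter k shift z).
  elim: k => [//|k IH] kT; have [ZE xE] := IH (ltnW kT).
  by rewrite !iterS /= fbk ?ZE ?xE// ltnW.
move=> k kT; have [ZE xE] := main k kT.
by rewrite /shifted_output /output /= fbk// ZE xE.
Qed.

End Closed_loop.

(** * Exact linearization *)

Section Linearization.
Context {R : realType} {q n m : nat}.
Local Notation traj := (traj R q n m).
Local Notation sn := (sn_traj (R := R) (q := q) (n := n) (m := m)).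
Let snP := @sn_traj_sn R q n m.
Context (f : 'rV[R]_(n + m) -> 'rV[R]_n) (g : 'rV[R]_(n + m) -> 'rV[R]_m).
Context (phi : 'M[R]_(q, m) * 'rV[R]_n * 'rV[R]_m -> 'rV[R]_m).
Context (x0 : 'rV[R]_n) (u0 : 'rV[R]_m).
Local Notation Z0 := (eq_past (q := q) g x0 u0).
Local Notation y0 := (eq_output (q := q) g phi x0 u0).
Local Notation eqt := (eq_traj (q := q) g x0 u0).
Context (df : {linear 'rV[R]_(n + m) -> 'rV[R]_n}).
Context (dg : {linear 'rV[R]_(n + m) -> 'rV[R]_m}).
Context (dphi : {linear ('M[R]_(q, m) * 'rV[R]_n * 'rV[R]_m)%type -> 'rV[R]_m}).
Hypothesis f_eq : f (row_mx x0 u0) = x0.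
Hypothesis f_diff : sdiff (nrm (V := _)) (nrm (V := _)) (row_mx x0 u0) f df.
Hypothesis g_diff : sdiff (nrm (V := _)) (nrm (V := _)) (row_mx x0 u0) g dg.
Hypothesis phi_diff : sdiff (nrm (V := _)) (nrm (V := _)) (Z0, x0, u0) phi dphi.
Context (s : nat) (blk : 'I_m -> nat) (tau : {perm 'I_m}) (K : nat -> 'I_m -> nat).
Hypothesis blk_le : forall j, (blk j <= s)%N.
Hypothesis coords_onto : onto df dg dphi blk tau K s.
Context (r : 'I_m -> nat).
Context (Fx : jetspace (R := R) r -> 'rV[R]_n).
Context (Fu : jetspace (R := R) (fun j => (r j).+1) -> 'rV[R]_m).
Context (vphi : forall j, nat ->
  'M[R]_(q, m) * 'rV[R]_n * jetspace (R := R) (lower_v_order blk K r j) -> R).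
Hypothesis flat : flat_parametrization f g phi x0 u0 Fx Fu.
Hypothesis lower : lower_shifts f g phi x0 u0 s tau vphi.
Local Notation kap := (kappa blk K).
Local Notation vo := (v_order blk K r).
Local Notation crd := (coords f g phi blk tau K s).
Local Notation dcrd := (dcoords df dg dphi blk tau K s).
Local Notation shift := (step f g open_loop).
Local Notation y := (shifted_output f g phi).
Local Notation dy k := (doutput df dg dphi k).
Local Notation fb := (linearizing_feedback Fu vphi).
Local Notation eqc := (Traj Z0 x0 (fun=> y0)).
Implicit Types z : traj.

Lemma coords_eq : crd eqt = eqc.
Proof.
apply: traj_ext => // a; apply/rowP => j.
by rewrite coords_outputE// output_eq.
Qed.

Lemma near_shift (P : traj -> Prop) k : near_sn sn eqt P ->
  near_sn sn eqt (fun z => forall l, (l <= k)%N -> P (iter l shift z)).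
Proof.
move=> nP; have near1 l : near_sn sn eqt (fun z => P (iter l shift z)).
  elim: l => [//|l IH].
  have sd : sdiff sn sn eqt shift (dstep df dg) := step_diff f_diff g_diff.
  have := sdiff_near (P := fun z => P (iter l shift z)) snP snP sd.
  rewrite step_eq// => /(_ IH); apply: near_snW => z /=.
  by rewrite -iterSr.
have := near_sn_all (I := 'I_k.+1) snP (fun l => near1 l).
by apply: near_snW => z zP l; rewrite -ltnS => lk; exact: (zP (Ordinal lk)).
Qed.

(** The coordinates are a submersion at the equilibrium, so every coordinate
    value near that of the equilibrium is attained, up to a window, by a
    trajectory that is as close to the equilibrium as desired. *)
Lemma coords_open (P : traj -> Prop) N : near_sn sn eqt P ->
  near_sn sn eqc (fun c => exists2 z, P z & window N (crd z) = window N c).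
Proof.
move=> nP; pose W : {linear traj -> _} := linear_pack (window_linear (R := R) (q := q) (n := n) (m := m) N).
have WL z : sdiff sn (nrm (V := _)) z (window N) W.
  apply: sdiff_linear; [exact: snP|exact: nrm_sn|move=> M].
  by exists N, 1; split=> // v; rewrite mul1r.
have cd := coords_diff f_eq f_diff g_diff phi_diff blk tau K s.
have Wcd := sdiff_comp snP snP (nrm_sn _) cd (WL _).
have Vf : findim ('M[R]_(q, m) * 'rV[R]_n * 'M[R]_(N, m))%type.
  by do 2?[apply: findim_prod]; exact: findim_mx.
have Wonto v : exists h, (W \o dcrd) h = v.
  case: v => [[Z x] U].
  pose c := Traj Z x (fun a => if insub a is Some b then row b U else 0) : traj.
  have [h hc] := coords_onto c; exists h.
  rewrite [LHS]/(window N (dcrd h)) [dcrd h]hc /window /=; congr (_, _).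
  apply/matrixP => a j; rewrite mxE /=; case: insubP => [b _ ba|].
    by rewrite mxE; congr (U _ _); exact: val_inj.
  by rewrite ltn_ord.
have := sdiff_open snP Vf Wcd Wonto nP; rewrite /= coords_eq.
by move=> /(sdiff_near snP (nrm_sn _) (WL eqc)); apply: near_snW => c [z Pz zc]; exists z.
Qed.

Lemma window_inj N (z z' : traj) : window N z = window N z' ->
  [/\ past z = past z', state z = state z' &
      forall a, (a < N)%N -> inp z a = inp z' a].
Proof.
case=> -> -> /matrixP uE; split=> // a aN; apply/rowP => j.
by have := uE (Ordinal aN) j; rewrite !mxE.
Qed.

Lemma near_lower : near_sn sn eqt (lower_shifts_at f g phi s tau vphi).
Proof.
have : near_sn sn eqt (fun z => forall j (a : 'I_(kap j)),
    y a z ord0 j = vphi a (past z, state z, jet (lower_v_order blk K r j) (inp (crd z)))).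
  apply: near_sn_all => [|j]; first exact: snP.
  apply: near_sn_all => [|a]; first exact: snP.
  by apply/near_trajP; have [] := lower (ltn_ord a).
by apply: near_snW => z zl j a ak; exact: (zl j (Ordinal ak)).
Qed.

Lemma near_param : near_sn sn eqt (param_at f g phi Fu).
Proof.
by case: flat => _ _ /near_trajP; apply: near_snW => z [].
Qed.

Lemma closed_loop_output T : near_sn sn eqc (fun c => forall k j, (k <= T)%N ->
  output f g phi fb (k + kap j) c ord0 j = inp c k ord0 j).
Proof.
(* times up to [T'] enter the claim, and the feedback at time [T'] reads [v] up
   to the order [vo] *)
pose T' := (T + \max_j kap j)%N; pose N := (T'.+1 + \max_j vo j)%N.
have := coords_open N (near_shift T' (near_snI snP near_lower near_param)).
apply: near_snW => c [z zG /window_inj[ZE xE vE]] k j kT.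
have kj : (k + kap j <= T')%N by rewrite leq_add// leq_bigmax.
have vN l : (T' + vo l <= N)%N by rewrite leq_add// leq_bigmax.
rewrite (closed_loop_follows blk_le vN _ _ _ zG)//; last first.
  by move=> a aN; rewrite vE.
rewrite -vE ?coords_outputE// ?[(k + _)%N]addnC//.
by rewrite /N addSn ltnS (leq_trans kT)// -addnA leq_addr.
Qed.

(** * The linearized outputs as functions of the state *)

Lemma coords_jet_linear (A : 'I_m -> nat) :
  linear (fun c : traj => (past c, state c, jet A (inp c))).
Proof. by move=> a c c'; congr (_, _); exact: jet_linear. Qed.

Lemma coords_jet_diff (A : 'I_m -> nat) c0 : sdiff sn (nrm (V := _)) c0
  (fun c => (past c, state c, jet A (inp c))) (linear_pack (coords_jet_linear A)).
Proof.
apply: sdiff_linear; [exact: snP|exact: nrm_sn|move=> M].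
exists (\max_j A j)%N, 1; split=> // h; rewrite mul1r /nrm /= !prod_normE /= !ge_max.
have [-> -> hv] := sn_traj_ge (\max_j A j) h.
apply: norm_mx_le => [|i j]; first exact: normr_ge0.
rewrite mxE (le_trans (norm_mx_entry _ _ _))// hv//.
by rewrite (leq_trans (ltn_ord _))// leq_bigmax.
Qed.

(** Chain rule for the representation of [y^j_[a]] by [vphi]. *)
Lemma lower_linear j a : (a < kap j)%N -> exists D : {linear
    ('M[R]_(q, m) * 'rV[R]_n * jetspace (R := R) (lower_v_order blk K r j))%type -> R},
  forall h, dy a h ord0 j =
    D (past h, state h, jet (lower_v_order blk K r j) (inp (dcrd h))).
Proof.
move=> aj; have [vs /near_trajP yv] := lower aj.
have Vf : findim ('M[R]_(q, m) * 'rV[R]_n * jetspace (R := R) (lower_v_order blk K r j))%type.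
  by do 2?[apply: findim_prod]; exact: findim_mx.
exists ('d (@vphi j a) (Z0, x0, jet (lower_v_order blk K r j) (fun=> y0))) => h.
have [l <- yl] := rdiff_entry ord0 j snP
  (output_diff f_eq f_diff g_diff phi_diff a).
have cd := coords_diff f_eq f_diff g_diff phi_diff blk tau K s.
have jd := sdiff_comp snP snP (nrm_sn _) cd
  (coords_jet_diff (lower_v_order blk K r j) _).
have vd : sdiff (nrm (V := _)) (nrm (V := R))
    ((fun c => (past c, state c, jet (lower_v_order blk K r j) (inp c))) (crd eqt))
    (@vphi j a) ('d (@vphi j a) (Z0, x0, jet (lower_v_order blk K r j) (fun=> y0))).
  by rewrite coords_eq; exact: smooth_sdiff.
have vcd := sdiff_comp snP (nrm_sn _) (nrm_sn _) jd vd.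
exact: (sdiff_unique snP yv yl vcd h).
Qed.

Lemma output_jet_linear : linear (fun z => jet r (fun k => dy k z)).
Proof.
move=> a z z'; rewrite -jet_linear; apply: eq_jet => j k _.
by rewrite linearP.
Qed.

(** Chain rule for the parametrization of the state by the flat output. *)
Lemma state_linear : exists D : {linear jetspace (R := R) r -> 'rV[R]_n},
  forall h, state h = D (jet r (fun k => dy k h)).
Proof.
have [Fxs _ /near_trajP nF] := flat.
exists ('d Fx (jet r (fun=> y0))) => h; apply/rowP => j.
have yd : sdiff sn (nrm (V := _)) eqt (fun z => jet r (y ^~ z))
    (linear_pack output_jet_linear).
  apply: sdiff_row => [|i]; first exact: snP.
  pose ja : pairs r := enum_val i.
  apply: rdiff_ext (rdiff_entry ord0 (tag ja) snP
    (output_diff f_eq f_diff g_diff phi_diff (tagged ja))) => z; rewrite mxE//.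
have Fd : sdiff (nrm (V := _)) (nrm (V := _)) (jet r (y ^~ eqt)) Fx
    ('d Fx (jet r (fun=> y0))).
  rewrite (_ : jet r (y ^~ eqt) = jet r (fun=> y0)).
    by apply: smooth_sdiff_row => //; exact: findim_mx.
  by apply: eq_jet => l a _; rewrite output_eq.
have [l' <- Fl] := rdiff_entry ord0 j snP (sdiff_comp snP (nrm_sn _) (nrm_sn _) yd Fd).
have [l <- sl] := rdiff_state eqt j.
apply: (sdiff_unique snP _ sl Fl h).
by apply: near_snW nF => z [-> _].
Qed.

Section Past_independent.
Hypothesis phi_past : \forall c \near (Z0, x0, u0) & c' \near (Z0, x0, u0),
  c.1.2 = c'.1.2 -> c.2 = c'.2 -> phi c = phi c'.

(** The state evolves independently of the past, so trajectories that differ only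
    in the past have equal outputs while both stay near the equilibrium. *)
Lemma output_past T : exists2 P : traj -> Prop, near_sn sn eqt P &
  forall z z', P z -> P z' -> state z = state z' -> inp z = inp z' ->
  forall k, (k <= T)%N -> y k z = y k z'.
Proof.
have [[A B] /= [nA nB] AB] := phi_past.
have nAB : near_sn (nrm (V := _)) (Z0, x0, u0) (fun c => A c /\ B c).
  have /near_ball_norm[d d0 dP] : \forall c \near (Z0, x0, u0), A c /\ B c.
    exact: filterI.
  by exists 0%N, d; split.
have npt := sdiff_near snP (nrm_sn _) (point_diff g x0 u0) nAB.
eexists; first exact: (near_shift T npt).
move=> z z' zP zP' xE uE.
have SE k : state (iter k shift z) = state (iter k shift z').
  elim: k => [//|k IH]; rewrite !iterS /= IH /open_loop.
  by rewrite !inp_iter_step uE.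
move=> k kT; have [/= Az _] := zP k kT; have [/= _ Bz'] := zP' k kT.
rewrite /shifted_output /output /open_loop.
by apply: (AB (_, _) (conj Az Bz')); rewrite /= ?inp_iter_step ?uE.
Qed.

(** Replacing the past in a trajectory changes neither the outputs nor, since
    [v] consists of outputs, the other coordinates. *)
Lemma phi_map_past :
  \forall c \near (Z0, x0, jet vo (fun=> y0)),
    phi_map vphi c = phi_map vphi (Z0, c.1.2, c.2).
Proof.
pose T := \max_j (kap j + (r j).+1)%N; pose N := \max_j vo j.
have [P nP yP] := output_past T.
have [M [d [d0 dP]]] := near_snI snP nP near_lower.
have nd : near_sn sn eqt (fun z => sn M (z - eqt) < d) by exists M, d.
have [M' [d' [d'0 dP']]] := coords_open N nd.
apply/near_ball_norm; exists d' => // -[[Z x] V] cd.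
(* beyond the jet [V], the equilibrium value keeps [c] near the equilibrium in
   every window *)
pose c := Traj Z x (fun a => \row_j
  if (a < vo j)%N then unjet V a ord0 j else y0 ord0 j) : traj.
have [|z zd /window_inj[ZE xE vE]] := dP' c.
  apply: le_lt_trans cd; set D := `|_|.
  have [ZD xD VD] : [/\ `|Z - Z0| <= D, `|x - x0| <= D &
      `|V - jet vo (fun=> y0)| <= D].
    by rewrite /D !prod_normE /= !le_max !lexx ?orbT.
  apply/sn_traj_le; first exact: normr_ge0.
  split=> // a _; apply: norm_mx_le => [|i j]; first exact: normr_ge0.
  rewrite (ord1 i) !mxE; case: ifP => av; last first.
    by rewrite subrr normr0 normr_ge0.
  apply: le_trans VD; apply: le_trans (unjet_entry_le _ a j).
  rewrite unjetB [X in _ <= `|X|]mxE [in X in _ <= `|_ + X|]mxE unjet_jet//.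
  by rewrite [unjet V a ord0 j]mxE.
have {}ZE : past z = Z := ZE.
have {}xE : state z = x := xE.
have [Pz lz] := dP z zd.
pose z' := Traj Z0 (state z) (inp z) : traj.
have [Pz' lz'] : P z' /\ lower_shifts_at f g phi s tau vphi z'.
  apply: dP; apply: le_lt_trans zd; have [h1 h2 h3] := sn_traj_ge M (z - eqt).
  apply/sn_traj_le; first exact: normr_ge0.
  by split=> //=; rewrite subrr normr0 normr_ge0.
have yz k : (k <= T)%N -> y k z = y k z' by apply: yP.
have crdV a j : (a < vo j)%N -> inp (crd z) a ord0 j = unjet V a ord0 j.
  by move=> av; rewrite vE ?mxE ?av// (leq_trans av)// leq_bigmax.
have VE : V = jet vo (inp (crd z)).
  by rewrite -[LHS]jet_unjet; apply: eq_jet => j a /crdV ->.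
have VE' : V = jet vo (inp (crd z')).
  rewrite VE; apply: eq_jet => j a av; rewrite !coords_outputE// yz//.
  rewrite (leq_trans _ (leq_bigmax j))// leq_add2l.
  by rewrite (leq_trans (ltnW av))// leq_subr.
have -> : phi_map vphi (Z, x, V) = jet (fun j => (r j).+1) (y ^~ z).
  by rewrite -ZE -xE VE phi_map_coords.
have -> : phi_map vphi (Z0, (Z, x, V).1.2, (Z, x, V).2) =
    jet (fun j => (r j).+1) (y ^~ z').
  by rewrite -[(Z, x, V).1.2]/x -[(Z, x, V).2]/V -xE VE' -(phi_map_coords blk_le lz').
apply: eq_jet => j a ar; rewrite yz//.
by rewrite (leq_trans (ltnW ar))// (leq_trans _ (leq_bigmax j))// leq_addl.
Qed.

Lemma dphi_past Z : dphi (Z, 0, 0) = 0.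
Proof.
have nS := nrm_sn ('M[R]_(q, m) * 'rV[R]_n * 'rV[R]_m)%type.
have [[A B] /= [/near_ball_norm[d d0 dP] nB] AB] := phi_past.
have nA : near_sn (nrm (V := _)) (Z0, x0, u0) A by exists 0%N, d; split.
apply: (line_deriv_unique (sdiff_line (Z, 0, 0) nS phi_diff)).
apply: (line_deriv_cst nS nA) => t At.
apply: (AB (_, (Z0, x0, u0))) => /=.
- by split=> //; exact: nbhs_singleton nB.
- by rewrite scaler0 addr0.
- by rewrite scaler0 addr0.
Qed.

Lemma doutput_past k Z : dy k (Traj Z 0 0) = 0.
Proof.
rewrite /= /shifted_output /output /open_loop /= inp_iter_step /=.
suff -> : state (iter k (step df dg open_loop) (Traj Z 0 (0 : nat -> 'rV[R]_m))) = 0.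
  exact: dphi_past.
elim: k => [//|k IH].
by rewrite iterS /= IH /open_loop inp_iter_step /= row_mx0 linear0.
Qed.

Lemma doutput_state_input k h : dy k h = dy k (Traj 0 (state h) (inp h)).
Proof.
rewrite -[LHS]subr0 -(doutput_past k (past h)) -linearB; congr (dy k _).
by apply: traj_ext => [||a] /=; rewrite ?subrr ?subr0.
Qed.

(** If [v = 0], the outputs depend on the past and the state only, and the past
    does not enter. *)
Lemma lower_state j a : (a < kap j)%N ->
  exists l : {linear 'rV[R]_n -> R}, forall h,
    (forall b, inp (dcrd h) b = 0) -> dy a h ord0 j = l (state h).
Proof.
move=> aj; have [D DE] := lower_linear aj.
have Dl : linear (fun x : 'rV[R]_n => D (0, x, 0)).
  move=> c x x'; rewrite -linearP; congr (D _); congr (_, _, _).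
    by rewrite /= scaler0 addr0.
  by rewrite /= scaler0 addr0.
exists (linear_pack Dl) => h h0; rewrite doutput_state_input DE /=.
congr (D (_, _, _)); rewrite -[RHS](jet0 (lower_v_order blk K r j)).
apply: eq_jet => l b _; rewrite -(h0 b) !mxE.
have yE k : shifted_output df dg dphi k (Traj 0 (state h) (inp h)) =
    shifted_output df dg dphi k h by have := doutput_state_input k h => /= ->.
by rewrite yE.
Qed.

(** The matrix [P] gives the outputs [y^j_[a]], [a < kappa^j], as functions of the
    state for [v = 0]; it is shown to be invertible. *)
Lemma kappa_sum : (\sum_j kap j)%N = n.
Proof.
have /choice[l lP] : forall i : 'I_#|{: pairs kap}|, exists l : {linear 'rV[R]_n -> R},
    forall h, (forall b, inp (dcrd h) b = 0) ->
      dy (tagged (enum_val i : pairs kap)) h ord0 (tag (enum_val i : pairs kap))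
      = l (state h).
  by move=> i; apply: lower_state; exact: ltn_ord.
have Ll : linear (fun x : 'rV[R]_n => \row_i l i x).
  by move=> c x x'; apply/rowP => i; rewrite !mxE linearP.
pose P := lin1_mx (linear_pack Ll).
have PE x i : (x *m P) ord0 i = l i x by rewrite mul_rV_lin1 mxE.
(* if these outputs vanish, so do the shifts of order [kappa^j] and more, which
   belong to [v = 0], and the flat parametrization makes the state vanish *)
have Pfree : row_free P.
  apply: inj_row_free => x xP.
  have [h hE] := coords_onto (Traj 0 x (fun=> 0)).
  have h0 b : inp (dcrd h) b = 0 by rewrite [dcrd h]hE.
  have -> : x = state h by rewrite -[state h]/(state (dcrd h)) [dcrd h]hE.
  have [D ->] := state_linear.
  rewrite (_ : jet r _ = 0) ?linear0// -[RHS](jet0 r).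
  apply: eq_jet => j a _; rewrite mxE.
  have [aj|ja] := ltnP a (kap j); last first.
    have := h0 (a - kap j)%N => /rowP/(_ j).
    by rewrite [LHS]coords_outputE// subnKC// mxE.
  pose i := enum_rank (@Tagged _ j (fun j => 'I_(kap j)) (Ordinal aj) : pairs kap).
  have := lP i h h0; rewrite enum_rankK /= => ->.
  by rewrite -PE -[state h]/(state (dcrd h)) [dcrd h]hE xP mxE.
(* among the outputs from time [k] on, a unit impulse in the input that drives
   [y^j0] at time [N] changes only that of [y^j0] at time [a0 + k]; as [N < k],
   the trajectory shifted by [k] steps has zero input, so its outputs are given
   by [P], and the coefficient of [y^j0_[a0]] in a linear relation among the
   rows of [P^T] is zero *)
have Pfull : row_free P^T.
  apply: inj_row_free => v vP; apply/rowP => i0; rewrite mxE.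
  case E0 : (enum_val i0) => [j0 a0].
  pose k := \max_j kap j.
  have kj j : (kap j <= k)%N by exact: leq_bigmax.
  pose N := (a0 + k - kap j0)%N.
  have Nk : (N < k)%N.
    by rewrite /N ltn_subLR ?ltn_add2r// (leq_trans (kj _))// leq_addl.
  have [h hE] := coords_onto (impulse N (delta_mx ord0 j0)).
  pose hk := iter k (step df dg open_loop) h.
  have hk0 b : inp (dcrd hk) b = 0.
    rewrite [LHS]coords_iter -[LHS]/(inp (dcrd h) (k + b)) [dcrd h]hE /=.
    by rewrite gtn_eqF// (leq_trans Nk)// leq_addr.
  have lE i : l i (state hk) = (i == i0)%:R.
    rewrite -lP//; case E : (enum_val i) => [j a] /=.
    rewrite output_shift.
    have ak : (kap j <= a + k)%N by rewrite (leq_trans (kj _))// leq_addl.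
    rewrite -[(a + k)%N](subnKC ak).
    have := coords_outputE df dg dphi tau K blk_le h (a + k - kap j) j.
    move=> <-; rewrite -[LHS]/(inp (dcrd h) (a + k - kap j) ord0 j) [dcrd h]hE /=.
    rewrite -(inj_eq enum_val_inj) E E0 -tag_eqE /tag_eq /= /N.
    have [jj|jj] := eqVneq j j0; last by case: ifP; rewrite ?mxE ?(negbTE jj) ?andbF.
    move: a a0 {E E0 N Nk h hE hk hk0} ak; rewrite jj => a a0 ak.
    rewrite tagged_asE -val_eqE /= -(eqn_add2r (kap j0)) subnK// subnK.
      by rewrite eqn_add2r; case: eqP; rewrite ?mxE ?eqxx.
    by rewrite (leq_trans (kj _))// leq_addl.
  have : (state hk *m P *m v^T) ord0 ord0 = 0.
    by rewrite -mulmxA -[P]trmxK -trmx_mul vP trmx0 mulmx0 mxE.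
  rewrite mxE (bigD1 i0)//= PE lE eqxx mul1r mxE big1 ?addr0// => i ii0.
  by rewrite PE lE (negbTE ii0) mul0r.
rewrite -card_pairs; apply/eqP; rewrite eqn_leq.
move: Pfree Pfull; rewrite /row_free mxrank_tr => /eqP Pn /eqP P'.
by rewrite -Pn P' leqnn.
Qed.

End Past_independent.

End Linearization.

(** * Linearization by the feedback *)

(** The function [g] is a component of the local diffeomorphism [(f, g)]. *)
Lemma rsub_diff (R : realType) n m (f : 'rV[R]_(n + m) -> 'rV[R]_n)
    (g : 'rV[R]_(n + m) -> 'rV[R]_m) w :
  smooth_near w (fun z => row_mx (f z) (g z)) ->
  exists dg : {linear 'rV[R]_(n + m) -> 'rV[R]_m},
    sdiff (nrm (V := _)) (nrm (V := _)) w g dg.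
Proof.
move=> /(smooth_sdiff_row (findim_mx 1 (n + m))) Gd.
set G := (fun z => _) in Gd.
have dl : linear (fun h => rsubmx ('d G w h)).
  by move=> a u v; rewrite !linearP.
exists (linear_pack dl); apply: sdiff_row => [|j]; first exact: nrm_sn.
apply: rdiff_ext (rdiff_entry ord0 (rshift n j) (nrm_sn _) Gd) => z /=.
  by rewrite row_mxEr.
by rewrite mxE.
Qed.

Unset Implicit Arguments.
Set Strict Implicit.

Theorem corollary4p6 (R : realType) (q n m : nat)
    (f : 'rV[R]_(n + m) -> 'rV[R]_n) (g : 'rV[R]_(n + m) -> 'rV[R]_m)
    (phi : 'M[R]_(q, m) * 'rV[R]_n * 'rV[R]_m -> 'rV[R]_m)
    (x0 : 'rV[R]_n) (u0 : 'rV[R]_m)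
    (r : 'I_m -> nat)
    (Fx : jetspace r -> 'rV[R]_n)
    (Fu : jetspace (fun j => (r j).+1) -> 'rV[R]_m)
    (s : nat) (blk : 'I_m -> nat) (tau : {perm 'I_m})
    (K : nat -> 'I_m -> nat)
    (vphi : forall j, nat ->
       'M[R]_(q, m) * 'rV[R]_n * jetspace (lower_v_order blk K r j) -> R)
    (Hsys : system_at f g x0 u0)
    (Hflat : flat_output f g phi x0 u0 Fx Fu)
    (Hproc : procedure f g phi x0 u0 s blk tau K)
    (Hvphi : lower_shifts f g phi x0 u0 s tau vphi) :
  let kap := kappa blk K in
  let Z0 : 'M[R]_(q, m) := eq_past g x0 u0 in
  let y0 := eq_output g phi x0 u0 in
  let feedback := linearizing_feedback Fu vphi in
  (forall T : nat, \forall c \near traj_nbhs (Traj Z0 x0 (fun=> y0)),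
     forall (k : nat) (j : 'I_m), (k <= T)%N ->
       output f g phi feedback (k + kap j) c ord0 j = inp c k ord0 j) /\
  ((\forall c \near (Z0, x0, u0) & c' \near (Z0, x0, u0),
      c.1.2 = c'.1.2 -> c.2 = c'.2 -> phi c = phi c') ->
   (exists phi_map0 : 'rV[R]_n * jetspace (v_order blk K r) ->
                      jetspace (fun j => (r j).+1),
      \forall c \near (Z0, x0, jet (v_order blk K r) (fun=> y0)),
        phi_map vphi c = phi_map0 (c.1.2, c.2)) /\
   (\sum_(j < m) kap j)%N = n).
Proof.
move=> kap Z0 y0 feedback.
have [f_eq f_smooth _ [/rsub_diff[dg g_diff] _]] := Hsys.
have [phi_smooth flat _] := Hflat.
have f_diff := smooth_sdiff_row (findim_mx 1 (n + m)) f_smooth.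
have Vf : findim ('M[R]_(q, m) * 'rV[R]_n * 'rV[R]_m)%type.
  by do 2?[apply: findim_prod]; exact: findim_mx.
have phi_diff := smooth_sdiff_row Vf phi_smooth.
have [coords_onto blk_le] := procedure_linear f_eq f_diff g_diff phi_diff Hproc.
split=> [T|phi_past].
  apply/near_trajP.
  exact: (closed_loop_output f_eq f_diff g_diff phi_diff blk_le coords_onto flat Hvphi T).
split; last first.
  exact: (kappa_sum f_eq f_diff g_diff phi_diff blk_le coords_onto flat Hvphi phi_past).
exists (fun xV => phi_map vphi (Z0, xV.1, xV.2)).
exact: (phi_map_past f_eq f_diff g_diff phi_diff blk_le coords_onto Hvphi phi_past).
Qed.
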